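(* Let $(q_n)$ be a sequence of positive integers with $q_n\to\infty$ and $q_n/n\to 0$ as $n\to\infty$. Let $X_i=\theta_i+\epsilon_i$, $i=1,\dots,n$, with $\epsilon_i$ i.i.d. $N(0,1)$, and consider testing $H_{0i}:\theta_i=0$ against $H_{1i}:\theta_i\neq0$ simultaneously for $i=1,\dots,n$ with the rule $\boldsymbol\psi=(\psi_1,\dots,\psi_n)$, $$\psi_i=\mathbf 1\Bigl\{\mathbb E(1-\kappa_i\mid X_i,\tau)>\tfrac12\Bigr\},$$ where the posterior shrinkage coefficient $\mathbb E(1-\kappa_i\mid X_i,\tau)$ (defined in the context) is computed under the one-group prior with exponent $a=\tfrac12$ and slowly varying function $L$. Assume that $\tau=\tau_n>0$ satisfies $\tau_n\to0$ and $n\tau_n/q_n\to C$ for some $C\in(0,\infty)$, and that $L$ satisfies (A1) and (A2) of the context. Then for every fixed $b\in\mathbb R$, $$\sup_{\boldsymbol\theta\in\boldsymbol\Theta_b}R(\boldsymbol\theta,\boldsymbol\psi)=1-\Phi(b)+o(1)\qquad (n\to\infty),$$ where $R=\mathrm{FDR}+\mathrm{FNR}$ and the beta-min class $\boldsymbol\Theta_b$ are defined in the context. The same conclusion holds with $b$ replaced by any real sequence $b=b_n\to\infty$.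
   Context: One-group shrinkage prior: given $\tau>0$, independently over $i$, $\theta_i\mid\lambda_i,\tau\sim N(0,\lambda_i^2\tau^2)$ and $\lambda_i^2$ has probability density $\pi_1(t)=K\,t^{-a-1}L(t)$ on $(0,\infty)$, where $a>0$, $L:(0,\infty)\to(0,\infty)$ is measurable, continuous and slowly varying (at infinity), and $K>0$ is the normalizing constant; $a$ and $L$ do not depend on $n$. (Horseshoe-type priors are those with $a=\tfrac12$.) Shrinkage coefficient: $\kappa_i=1/(1+\lambda_i^2\tau^2)$, and $\mathbb E(1-\kappa_i\mid X_i,\tau)$ denotes the posterior mean of $1-\kappa_i$ given $X_i$ under this prior and $X_i\mid\theta_i\sim N(\theta_i,1)$; explicitly $$\mathbb E(1-\kappa_i\mid X_i=x,\tau)=\frac{\int_0^\infty \frac{t\tau^2}{1+t\tau^2}(1+t\tau^2)^{-1/2}e^{-x^2/(2(1+t\tau^2))}\,t^{-a-1}L(t)\,dt}{\int_0^\infty (1+t\tau^2)^{-1/2}e^{-x^2/(2(1+t\tau^2))}\,t^{-a-1}L(t)\,dt}.$$ Assumptions on $L$: (A1) there exist $c_0>0$ and $t_0>0$ such that $L(t)\ge c_0$ for all $t\ge t_0$; (A2) there exists $M\in(0,\infty)$ such that $\sup_{t\in(0,\infty)}L(t)\le M$. Beta-min class: for real $b$ (possibly depending on $n$), $\boldsymbol\Theta_b=\{\boldsymbol\theta\in\mathbb R^n:\ |S_{\boldsymbol\theta}|=q_n,\ |\theta_i|\ge\sqrt{2\log(n/q_n)}+b\ \text{for all } i\in S_{\boldsymbol\theta}\}$,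 where $S_{\boldsymbol\theta}=\{i:\theta_i\ne0\}$. Risk: $R(\boldsymbol\theta,\boldsymbol\psi)=\mathrm{FDR}(\boldsymbol\theta,\boldsymbol\psi)+\mathrm{FNR}(\boldsymbol\theta,\boldsymbol\psi)$, where $$\mathrm{FDR}(\boldsymbol\theta,\boldsymbol\psi)=\mathbb E_{\boldsymbol\theta}\left[\frac{\sum_{i:\theta_i=0}\psi_i}{\max\{\sum_{i=1}^n\psi_i,1\}}\right],\qquad \mathrm{FNR}(\boldsymbol\theta,\boldsymbol\psi)=\mathbb E_{\boldsymbol\theta}\left[\frac{\sum_{i:\theta_i\ne0}(1-\psi_i)}{\max\{|S_{\boldsymbol\theta}|,1\}}\right].$$ $\mathbb E_{\boldsymbol\theta}$ is expectation when the true mean vector is the fixed vector $\boldsymbol\theta$. $\Phi$ is the standard normal distribution function. *)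

(* Defs.v *)
(* MathComp / MathComp-Analysis *)
From mathcomp Require Import all_boot all_order all_algebra.
From mathcomp Require Import all_classical all_reals all_analysis.
Set Implicit Arguments.
Unset Strict Implicit.
Unset Printing Implicit Defensive.
Import Order.TTheory GRing.Theory Num.Theory.
Import numFieldNormedType.Exports.
Local Open Scope classical_set_scope.
Local Open Scope ring_scope.

Section OneGroupPrior.
Context {R : realType}.
Implicit Types (L : R -> R) (a K tau x : R).

Definition slowly_varying L : Prop :=
  forall c : R, 0 < c -> L (c * t) / L t @[t --> +oo] --> (1 : R).

Definition prior_density K a L (t : R) : R := K * t `^ (- a - 1) * L t.

(* The values of L outside ]0, +oo[ are irrelevant.  The last clause says that
   K is the normalizing constant of the density of lambda_i^2. *)
Definition one_group_prior K a L : Prop :=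
  [/\ 0 < a,
      forall t, 0 < t -> 0 < L t,
      measurable_fun (`]0, +oo[%classic : set R) L /\ {in `]0, +oo[, continuous L},
      slowly_varying L
    & 0 < K /\
      (\int[lebesgue_measure]_(t in `]0%R, +oo[) (prior_density K a L t)%:E
         = 1)%E].

Definition assumption_A1 L : Prop :=
  exists c0 t0 : R, [/\ 0 < c0, 0 < t0 & forall t, t0 <= t -> c0 <= L t].

Definition assumption_A2 L : Prop :=
  exists2 M : R, 0 < M & forall t, 0 < t -> L t <= M.

(* Up to constants that cancel in the ratio below, the posterior density of
   lambda_i^2 at t given X_i = x: marginally over theta_i,
   X_i | lambda_i^2 = t is N(0, 1 + t tau^2). *)
Definition posterior_weight a L tau x (t : R) : R :=
  (1 + t * tau ^+ 2) `^ (- 2^-1) * expR (- (x ^+ 2 / (2 * (1 + t * tau ^+ 2))))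
    * t `^ (- a - 1) * L t.

(* E(1 - kappa_i | X_i = x, tau), where
   1 - kappa_i = t tau^2 / (1 + t tau^2) at lambda_i^2 = t. *)
Definition posterior_shrinkage a L tau x : R :=
  (\int[lebesgue_measure]_(t in `]0, +oo[)
     (t * tau ^+ 2 / (1 + t * tau ^+ 2) * posterior_weight a L tau x t)) /
  (\int[lebesgue_measure]_(t in `]0, +oo[) posterior_weight a L tau x t).

End OneGroupPrior.

Section MultipleTesting.
Context {R : realType} {n : nat}.
Implicit Types (theta x : 'rV[R]_n) (psi : 'rV[R]_n -> 'I_n -> bool).

Definition one_group_test (a : R) (L : R -> R) (tau : R) (x : 'rV[R]_n)
    (i : 'I_n) : bool :=
  2^-1 < posterior_shrinkage a L tau (x ord0 i).

Definition support_set theta : {set 'I_n} := [set i | theta ord0 i != 0]%SET.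

Definition beta_min_class (q : nat) (b : R) : set 'rV[R]_n :=
  [set theta | #|support_set theta| = q /\
    forall i, i \in support_set theta ->
      Num.sqrt (2 * ln (n%:R / q%:R)) + b <= `|theta ord0 i| ].

Definition fdp theta (r : 'I_n -> bool) : R :=
  (\sum_(i | theta ord0 i == 0%R) r i)%N%:R / (maxn (\sum_i r i) 1)%:R.

Definition fnp theta (r : 'I_n -> bool) : R :=
  (\sum_(i | theta ord0 i != 0%R) ~~ r i)%N%:R / (maxn #|support_set theta| 1)%:R.

Context {d : measure_display} {T : measurableType d} (P : probability T R).
Variable eps : 'I_n -> T -> R.

Definition observation theta (w : T) : 'rV[R]_n :=
  \row_i (theta ord0 i + eps i w).

Definition FDR theta psi : \bar R :=
  'E_P[fun w => fdp theta (psi (observation theta w))].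

Definition FNR theta psi : \bar R :=
  'E_P[fun w => fnp theta (psi (observation theta w))].

Definition risk theta psi : \bar R := (FDR theta psi + FNR theta psi)%E.

End MultipleTesting.

Section Gaussian.
Context {R : realType}.

Definition std_normal_cdf (b : R) : R := fine (normal_prob 0 1 `]-oo, b]).

(* For a finite index set the product rule over the full family entails the
   one over every subfamily, by taking B i = setT off the subfamily. *)
Definition mutually_independent {d : measure_display} {T : measurableType d}
    (P : probability T R) (I : finType) (X : I -> T -> R) : Prop :=
  forall B : I -> set R, (forall i, measurable (B i)) ->
    P [set w | forall i, B i (X i w)] =
      (\prod_i fine (P (X i @^-1` B i)))%:E.

(* The laws are compared on Borel sets only: both sides are total functions,
   with meaningless values on non-measurable sets. *)
Definition iid_std_normal {d : measure_display} {T : measurableType d}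
    (P : probability T R) (I : finType) (X : I -> {RV P >-> R}) : Prop :=
  (forall i (A : set R), measurable A ->
     distribution P (X i) A = normal_prob 0 1 A) /\
  mutually_independent P (fun i => X i : T -> R).

End Gaussian.

(* Main.v *)
(* Idea. Write u = t tau^2 and h = (u - 1)/(u + 1). Since E(1 - kappa | x) - 1/2 is a
   positive multiple of int h exp(-x^2/(2(1+u))) ..., multiplying by exp(x^2/4) turns the
   exponential into exp(x^2 h/4), whose exponent has the sign of h: the rejection
   region is therefore { |x| large }. Prior mass at t = O(1) contributes
   -exp(-x^2/4) and the heavy tail u ~ x^2 contributes tau exp(x^2/4) / x^2, so that
   rejection forces exp(-x^2/2) = O(tau), and is certain once
   tau exp(x^2/2) >> x^2. With s = sqrt(2 log(n/q)) and tau ~ C exp(-s^2/2), the critical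
   value is s + o(1), while the type I error is o(q/n) by Mills' ratio. The number of
   true positives is of order q by Chebyshev's inequality, so the FDR vanishes, and the FNR is
   at most Phi(-b) + o(1), with equality when every nonzero mean equals s + b. *)
Require Import Defs.
From mathcomp Require Import all_boot all_order all_algebra.
From mathcomp Require Import all_classical all_reals all_analysis.
From mathcomp Require Import measurable_realfun ring lra.
Import Order.TTheory GRing.Theory Num.Theory.
Import numFieldNormedType.Exports.
Local Open Scope classical_set_scope.
Local Open Scope ring_scope.

(** * Standard normal tails *)

Section GaussianTail.
Context {R : realType}.
Notation mu := (@lebesgue_measure R).
Notation gauss := (@normal_prob R 0 1).
Notation Phi := (@std_normal_cdf R).


(** The exact critical value is never computed. The test is sandwiched between two two-sided tests,
    and the risk bounds hold for any measurable coordinatewise test so sandwiched; the prior enters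
    only through the two thresholds. On the lower side, the constant in exp(-x^2/2) = O(tau) moves
    the threshold by O(1/s) only. On the upper side a factor x^2 is lost, which is harmless because
    going from s to s + e multiplies exp(x^2/2) by at least exp(s e). The delicate term is the type
    I error: at the lower threshold y, exp(-y^2/2) is merely of order q/n, and the whole gain is the
    factor 1/y of Mills' ratio. The o(1) statements are kept as bounds with an arbitrary e > 0,
    valid for n large and uniformly in theta; a diverging b is reduced to a fixed one by
    monotonicity of the class. *)

Lemma normal_pdf_even (x : R) : normal_pdf 0 1 (- x) = normal_pdf 0 1 x.
Proof.
by rewrite normal_pdfE ?oner_neq0// /normal_fun !subr0 sqrrN.
Qed.

Lemma normal_peak1_le1 : @normal_peak R 1 <= 1.
Proof.
rewrite /normal_peak expr1n mul1r invf_le1; last first.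
  by rewrite sqrtr_gt0 mulrn_wgt0// pi_gt0.
rewrite -[leLHS]sqrtr1 ler_sqrt; last by rewrite mulrn_wge0// pi_ge0.
have := @pi_ge2 R; rewrite mulr2n; lra.
Qed.

Lemma normal_prob_fin_num (A : set R) : measurable A -> gauss A \is a fin_num.
Proof. by move=> mA; exact: fin_num_measure. Qed.

Lemma fine_gauss_le (A B : set R) : measurable A -> measurable B -> A `<=` B ->
  fine (gauss A) <= fine (gauss B).
Proof.
move=> mA mB AB; rewrite fine_le ?normal_prob_fin_num//.
by apply: le_measure => //; rewrite inE.
Qed.

Lemma fine_gauss_ge0 (A : set R) : 0 <= fine (gauss A).
Proof. by rewrite fine_ge0. Qed.

Lemma fine_gauss_le1 (A : set R) : measurable A -> fine (gauss A) <= 1.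
Proof.
move=> mA; rewrite -lee_fin fineK ?normal_prob_fin_num//.
exact: probability_le1.
Qed.

Lemma measurable_EFin_normal_pdf (D : set R) :
  measurable_fun D (EFin \o @normal_pdf R 0 1).
Proof.
by apply/measurable_EFinP; apply: measurable_funTS; exact: measurable_normal_pdf.
Qed.

Lemma gauss_upper_tail (b : R) : gauss `[b, +oo[ = (Phi (- b))%:E.
Proof.
rewrite /std_normal_cdf fineK ?normal_prob_fin_num// /normal_prob.
rewrite ge0_integration_by_substitutionNy.
- by apply: eq_integral => x _; rewrite /= normal_pdf_even.
- by apply: continuous_subspaceT; exact: continuous_normal_pdf.
- by move=> x _; exact: normal_pdf_ge0.
Qed.

Lemma gauss_lower_open (b : R) : gauss `]-oo, b[ = (Phi b)%:E.
Proof.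
rewrite /std_normal_cdf fineK ?normal_prob_fin_num// /normal_prob.
by rewrite integral_itv_bndo_bndc//; exact: measurable_EFin_normal_pdf.
Qed.

Lemma Phi_opp (b : R) : Phi (- b) = 1 - Phi b.
Proof.
apply: EFin_inj; rewrite -gauss_upper_tail EFinB -gauss_lower_open.
rewrite -probability_setC//; congr (gauss _).
by rewrite setCitvl.
Qed.

Lemma Phi_nondecreasing (x y : R) : x <= y -> Phi x <= Phi y.
Proof.
by move=> xy; apply: fine_gauss_le => //; apply: subset_itvl; rewrite bnd_simp.
Qed.

Lemma Phi_le1 (x : R) : Phi x <= 1.
Proof. exact: fine_gauss_le1. Qed.

Lemma gauss_itv (x y : R) : x <= y -> fine (gauss `]x, y]) = Phi y - Phi x.
Proof.
move=> xy.
have -> : Phi y = fine (gauss `]-oo, x] + gauss `]x, y])%E.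
  rewrite /std_normal_cdf -measureU//; last first.
    apply/seteqP; split => // z [] /=; rewrite !in_itv/= => zx /andP[xz _].
    by move: (lt_le_trans xz zx); rewrite ltxx.
  by rewrite -itv_bndbnd_setU.
rewrite [X in _ = X - _]fineD ?normal_prob_fin_num//.
by rewrite /std_normal_cdf addrAC subrr add0r.
Qed.

(** The density is at most 1 because its peak is. This turns an error in the threshold into an error
    of at most the same size in the risk. *)
Lemma Phi_lipschitz (x y : R) : x <= y -> Phi y - Phi x <= y - x.
Proof.
move=> xy; rewrite -gauss_itv// -lee_fin fineK ?normal_prob_fin_num//.
rewrite /normal_prob.
apply: (@le_trans _ _ (\int[mu]_(t in `]x, y]) cst 1%:E t)%E).
  apply: ge0_le_integral => //.
  - by move=> t _; rewrite lee_fin normal_pdf_ge0.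
  - exact: measurable_EFin_normal_pdf.
  - move=> t _; rewrite lee_fin (le_trans _ normal_peak1_le1)//.
    by rewrite normal_pdf_ub ?oner_neq0.
rewrite integral_cst//= lebesgue_measure_itv/= lte_fin.
by case: ifP => _; rewrite mul1e// lee_fin subr_ge0.
Qed.

(** On x >= y the density is at most (x / y) exp(-x^2/2), which has an explicit antiderivative; the
    normalizing peak is simply bounded by 1. *)
Lemma Mills_upper (y : R) : 0 < y -> Phi (- y) <= expR (- (y ^+ 2 / 2)) / y.
Proof.
move=> y0; rewrite -lee_fin -gauss_upper_tail /normal_prob.
set F := fun x : R => - (expR (- (x ^+ 2 / 2)) / y).
have dF (x : R) : is_derive x 1 F (x / y * expR (- (x ^+ 2 / 2))).
  rewrite /F; apply: is_derive_eq.
  by rewrite !scaler0 !add0r /GRing.scale/=; field; rewrite gt_eqF.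
have cf : continuous (fun x : R => x / y * expR (- (x ^+ 2 / 2))).
  move=> x; apply: cvgM; first by apply: cvgMl; exact: cvg_id.
  apply: continuous_comp; last exact: continuous_expR.
  by apply: cvgN; apply: cvgM; [exact: exprn_continuous|exact: cvg_cst].
apply: (@le_trans _ _
  (\int[mu]_(x in `[y, +oo[) (x / y * expR (- (x ^+ 2 / 2)))%:E)%E).
  apply: ge0_le_integral => //.
  - by move=> t _; rewrite lee_fin normal_pdf_ge0.
  - exact: measurable_EFin_normal_pdf.
  - apply/measurable_EFinP; apply: measurable_funTS.
    exact: continuous_measurable_fun.
  - move=> t; rewrite /= in_itv/= andbT => yt; rewrite lee_fin normal_pdfE ?oner_neq0//.
    rewrite /normal_fun subr0 expr1n mulNr ler_pM ?normal_peak_ge0 ?expR_ge0//.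
    by rewrite (le_trans normal_peak1_le1)// ler_pdivlMr// mul1r.
rewrite (@ge0_continuous_FTC2y _ _ F _ 0).
- by rewrite sub0e /F -EFinN opprK.
- move=> x yx; rewrite mulr_ge0 ?expR_ge0// divr_ge0// ltW//.
  exact: lt_le_trans yx.
- exact: continuous_subspaceT.
- rewrite -[X in _ --> X]oppr0; apply: cvgN.
  rewrite -[X in _ --> X](mul0r y^-1); apply: cvgM; last exact: cvg_cst.
  apply: (@cvg_comp _ _ _ (fun x : R => x ^+ 2 / 2) (fun u => expR (- u)) _ +oo);
    last exact: cvgr_expR.
  apply/cvgryPge => r; near=> x.
  have x2 : 2 <= x by near: x; exact: nbhs_pinfty_ge.
  have xr : r <= x by near: x; apply: nbhs_pinfty_ge; exact: num_real.
  rewrite expr2; nra.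
- by move=> x _; have [] := dF x.
- apply: cvg_at_right_filter; apply: differentiable_continuous.
  by apply/derivable1_diffP; have [] := dF y.
- by move=> x _; rewrite derive1E; have [_] := dF x.
Unshelve. all: by end_near. Qed.

Lemma Phi_tail (y : R) : 0 < y -> Phi (- y) <= y^-1.
Proof.
move=> y0; apply: (le_trans (Mills_upper y y0)).
by rewrite ler_pdivrMr// mulVf ?gt_eqF// expR_le1 oppr_le0 divr_ge0// sqr_ge0.
Qed.
Lemma Phi_gt0 (x : R) : 0 < Phi x.
Proof.
(* On the interval from x - 1 to x one has |t| <= |x| + 1, so [c] bounds the density from below
   there. *)
set c := @normal_peak R 1 * expR (- ((`|x| + 1) ^+ 2 / 2)).
have c_gt0 : 0 < c by rewrite mulr_gt0 ?expR_gt0// normal_peak_gt0// oner_neq0.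
apply: (lt_le_trans c_gt0).
rewrite -lee_fin /std_normal_cdf fineK ?normal_prob_fin_num//.
apply: (@le_trans _ _ (gauss `[(x - 1)%R, x]%classic)); last first.
  by apply: le_measure; rewrite ?inE//; apply: subset_itvr.
rewrite /normal_prob.
apply: (@le_trans _ _ (\int[lebesgue_measure]_(t in `[(x - 1)%R, x]) cst c%:E t)%E).
  rewrite integral_cst//= lebesgue_measure_itv/= lte_fin ltrBlDr ltrDl ltr01.
  by rewrite -EFinB -EFinM lee_fin opprB addrCA subrr addr0 mulr1.
apply: ge0_le_integral => //.
- by move=> t _; rewrite lee_fin ltW.
- exact: measurable_EFin_normal_pdf.
move=> t /=; rewrite in_itv/= => /andP[xt tx].
rewrite lee_fin normal_pdfE ?oner_neq0// /normal_fun subr0 expr1n mulNr.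
rewrite ler_wpM2l ?normal_peak_ge0// ler_expR lerN2 ler_wpM2r ?invr_ge0//.
rewrite -(real_normK (num_real t)) lerXn2r ?nnegrE ?addr_ge0//.
have := ler_norm x; have := ler_norm (- x); rewrite normrN => ? ?.
by rewrite ler_norml; apply/andP; split; lra.
Qed.

End GaussianTail.

(** * The shrinkage contrast and the rejection threshold *)

Section PowerTail.
Context {R : realType}.
Notation mu := (@lebesgue_measure R).

Lemma powR_neg3half (t : R) : 0 < t ->
  t `^ (- 2^-1 - 1) = (t * Num.sqrt t)^-1.
Proof.
move=> t0; rewrite -opprD powRN powRD; last by rewrite gt_eqF// implybT.
by rewrite powR12_sqrt ?ltW// powRr1 ?ltW// mulrC.
Qed.

(** At [a = tau^-2], that is u = 1, the value is 2 tau: this is the origin of the factor tau in the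
    tail contributions. *)
Lemma integral_powR_neg3half (a : R) : 0 < a ->
  (\int[mu]_(t in `[a, +oo[) (t `^ (- 2^-1 - 1))%:E)%E = (2 / Num.sqrt a)%:E.
Proof.
move=> a0; set F := fun t : R => - 2 * t `^ (- 2^-1).
have dF (t : R) : 0 < t -> is_derive t 1 F (t `^ (- 2^-1 - 1)).
  move=> t0; have ? := is_derive1_powR (- 2^-1) t0.
  by apply: is_derive_eq; rewrite /GRing.scale/=; field.
have sqrtE (t : R) : 0 <= t -> F t = - 2 / Num.sqrt t.
  by move=> t0; rewrite /F powRN powR12_sqrt.
rewrite (@ge0_continuous_FTC2y _ _ F _ 0).
- by rewrite sub0e sqrtE ?ltW// -EFinN mulNr opprK.
- by move=> t _; rewrite powR_ge0.
- apply: derivable_within_continuous => t; rewrite in_itv/= andbT => at_.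
  by apply: derivable_powR; rewrite in_itv/= andbT (lt_le_trans a0).
- apply/cvgr0Pnorm_le => e e0; near=> t.
  have t0 : 0 < t by near: t; apply: nbhs_pinfty_gt; exact: num_real.
  have te : (2 / e) ^+ 2 < t by near: t; apply: nbhs_pinfty_gt; exact: num_real.
  rewrite sqrtE ?ltW// mulNr normrN ger0_norm ?divr_ge0 ?sqrtr_ge0//.
  rewrite ltr_pdivrMr ?sqrtr_gt0// mulrC -ltr_pdivrMr//.
  rewrite -[ltLHS]ger0_norm ?divr_ge0 ?(ltW e0)//.
  by rewrite -sqrtr_sqr ltr_sqrt.
- by move=> t a_t; have [] := dF t (lt_trans a0 a_t).
- apply: cvg_at_right_filter; apply: differentiable_continuous.
  by apply/derivable1_diffP; have [] := dF a a0.
- move=> t; rewrite in_itv/= andbT => a_t.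
  by rewrite derive1E; have [_] := dF t (lt_trans a0 a_t).
Unshelve. all: by end_near. Qed.

End PowerTail.

Section ShrinkageContrast.
Context {R : realType}.
Notation mu := (@lebesgue_measure R).
Implicit Types (L : R -> R) (tau x t : R).

(** The prior density without its normalizing constant, so that its total mass is 1/K. *)
Definition prior_kernel L t : R := t `^ (- 2^-1 - 1) * L t.

(** This is 1 - 2 kappa, the h of the overview; it changes sign at t = tau^-2. *)
Definition shrink_gap tau t : R := 1 - 2 / (1 + t * tau ^+ 2).

Definition damping tau t : R := (1 + t * tau ^+ 2) `^ (- 2^-1).

Definition contrast_factor tau x t : R :=
  shrink_gap tau t * expR (x ^+ 2 / 4 * shrink_gap tau t) * damping tau t.

Definition contrast L tau x : R :=
  \int[mu]_(t in `]0, +oo[) (contrast_factor tau x t * prior_kernel L t).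

Lemma one_plus_gt0 tau t : 0 < t -> 0 < 1 + t * tau ^+ 2.
Proof. by move=> t0; rewrite ltr_wpDr// mulr_ge0 ?sqr_ge0// ltW. Qed.

Lemma shrink_gapE tau t : 0 < t ->
  shrink_gap tau t = (t * tau ^+ 2 - 1) / (1 + t * tau ^+ 2).
Proof.
move=> /(one_plus_gt0 tau) u0; rewrite /shrink_gap; field.
by rewrite gt_eqF.
Qed.

Lemma normr_shrink_gap_le1 tau t : 0 < t -> `|shrink_gap tau t| <= 1.
Proof.
move=> t0; have u0 := one_plus_gt0 tau t t0; rewrite shrink_gapE//.
have := sqr_ge0 tau; rewrite normrM normfV (gtr0_norm u0) ler_pdivrMr// mul1r ler_norml.
by move=> tau0; apply/andP; split; nra.
Qed.

Lemma damping_gt0 tau t : 0 < t -> 0 < damping tau t.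
Proof. by move=> /(one_plus_gt0 tau); exact: powR_gt0. Qed.

Lemma dampingE tau t : 0 < t -> damping tau t = (Num.sqrt (1 + t * tau ^+ 2))^-1.
Proof.
by move=> /(one_plus_gt0 tau) u0; rewrite /damping powRN powR12_sqrt// ltW.
Qed.

Lemma damping_le1 tau t : 0 < t -> damping tau t <= 1.
Proof.
move=> t0; have u0 := one_plus_gt0 tau t t0.
rewrite dampingE// invf_le1 ?sqrtr_gt0//.
have : Num.sqrt 1 <= Num.sqrt (1 + t * tau ^+ 2).
  by apply: ler_wsqrtr; rewrite lerDl mulr_ge0 ?sqr_ge0// ltW.
by rewrite sqrtr1.
Qed.

Lemma measurable_shrink_gap tau : measurable_fun (`]0, +oo[ : set R) (shrink_gap tau).
Proof.
apply: measurable_funB => //.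
(* The inverse is handled as the power with exponent -1, which agrees with it on positive
   numbers. *)
apply: (eq_measurable_fun (fun t => 2 * (1 + t * tau ^+ 2) `^ (-1))).
  move=> t; rewrite inE/= in_itv/= andbT => t0.
  by rewrite powR_inv1// ltW// one_plus_gt0.
apply: measurable_funM => //.
apply: (measurableT_comp (measurable_powR _)).
by apply: measurable_funD => //; exact: measurable_funM.
Qed.

Lemma measurable_damping tau (A : set R) : measurable_fun A (damping tau).
Proof.
apply: (measurableT_comp (measurable_powR _)).
by apply: measurable_funD => //; exact: measurable_funM.
Qed.

Lemma measurable_contrast_factor tau x :
  measurable_fun (`]0, +oo[ : set R) (contrast_factor tau x).
Proof.
have mg := measurable_shrink_gap tau.
apply: measurable_funM; last exact: measurable_damping.
apply: measurable_funM => //; apply: measurableT_comp => //.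
exact: measurable_funM.
Qed.

Lemma normr_contrast_factor_le tau x t : 0 < t ->
  `|contrast_factor tau x t| <= expR (x ^+ 2 / 4).
Proof.
move=> t0; have g1 := normr_shrink_gap_le1 tau t t0.
rewrite /contrast_factor 2!normrM -[leRHS]mulr1 ler_pM//; last 1 first.
  by rewrite gtr0_norm ?damping_gt0// damping_le1.
rewrite -[leRHS]mul1r ler_pM// gtr0_norm ?expR_gt0// ler_expR.
rewrite ler_piMr ?divr_ge0 ?sqr_ge0//.
by move: g1; rewrite ler_norml => /andP[].
Qed.

(* The exponential tilting by [x ^+ 2 / 4] matches the threshold 1/2: the gap and
   the exponent have the same sign. *)
Lemma contrast_factor_homo tau t x y : 0 < t -> `|x| <= `|y| ->
  contrast_factor tau x t <= contrast_factor tau y t.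
Proof.
move=> t0 xy; rewrite /contrast_factor ler_pM2r ?damping_gt0//.
have x2y2 : x ^+ 2 <= y ^+ 2.
  by rewrite -(real_normK (num_real x)) -(real_normK (num_real y)) lerXn2r ?nnegrE.
have [g0|/ltW g0] := leP 0 (shrink_gap tau t).
  by rewrite ler_wpM2l// ler_expR ler_wpM2r// ler_wpM2r.
by rewrite ler_wnM2l// ler_expR ler_wnM2r// ler_wpM2r.
Qed.

Lemma posterior_weightE L tau x t : 0 < t ->
  expR (x ^+ 2 / 4) * (shrink_gap tau t * posterior_weight 2^-1 L tau x t) =
  contrast_factor tau x t * prior_kernel L t.
Proof.
move=> t0; have u0 := one_plus_gt0 tau t t0.
rewrite /contrast_factor /posterior_weight /prior_kernel -/(damping tau t).
have -> : expR (x ^+ 2 / 4 * shrink_gap tau t) =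
    expR (x ^+ 2 / 4) * expR (- (x ^+ 2 / (2 * (1 + t * tau ^+ 2)))).
  rewrite -expRD; congr expR; rewrite /shrink_gap; field.
  by rewrite gt_eqF.
ring.
Qed.

Section Integrability.
Variables (L : R -> R) (K : R).
Hypothesis hprior : one_group_prior K 2^-1 L.

Lemma prior_kernel_gt0 t : 0 < t -> 0 < prior_kernel L t.
Proof.
by have [_ L0 _ _ _] := hprior => t0; rewrite mulr_gt0 ?powR_gt0 ?L0.
Qed.

Lemma measurable_prior_kernel : measurable_fun (`]0, +oo[ : set R) (prior_kernel L).
Proof.
have [_ _ [mL _] _ _] := hprior; apply: measurable_funM => //.
by apply: measurable_funTS; exact: measurable_powR.
Qed.

Lemma integral_prior_kernel :
  (\int[mu]_(t in `]0%R, +oo[) (prior_kernel L t)%:E)%E = K^-1%:E.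
Proof.
have [_ _ _ _ [K0 intK]] := hprior.
have : (K%:E * \int[mu]_(t in `]0%R, +oo[) (prior_kernel L t)%:E = 1)%E.
  rewrite -intK -ge0_integralZl_EFin ?ltW//.
  - by apply: eq_integral => t _; rewrite /prior_density /prior_kernel -EFinM mulrA.
  - by move=> t /=; rewrite in_itv/= andbT => t0; rewrite lee_fin ltW ?prior_kernel_gt0.
  - by apply/measurable_EFinP; exact: measurable_prior_kernel.
move=> /(congr1 (fun y => K^-1%:E * y)%E).
by rewrite muleA -EFinM mulVf ?gt_eqF// mul1e mule1.
Qed.

Lemma integrable_prior_kernel :
  mu.-integrable (`]0%R, +oo[ : set R) (EFin \o prior_kernel L).
Proof.
apply/integrableP; split.
  by apply/measurable_EFinP; exact: measurable_prior_kernel.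
under eq_integral => t.
  rewrite inE/= in_itv/= andbT => t0.
  rewrite ger0_norm ?(ltW (prior_kernel_gt0 t t0))//; over.
by rewrite integral_prior_kernel ltry.
Qed.

Lemma integrable_mul_prior_kernel (A : set R) (k : R -> R) (c : R) :
  measurable A -> A `<=` `]0, +oo[ -> measurable_fun A k ->
  (forall t, A t -> `|k t| <= c) ->
  mu.-integrable A (EFin \o (fun t => k t * prior_kernel L t)).
Proof.
move=> mA AD mk kc.
apply: (@integrableMr _ _ _ mu A mA k (EFin \o prior_kernel L)) => //.
  exists c; split; first exact: num_real.
  by move=> y cy t At; exact: le_trans (kc _ At) (ltW cy).
exact: integrableS integrable_prior_kernel.
Qed.

Lemma integrable_contrast (A : set R) tau x : measurable A -> A `<=` `]0, +oo[ ->
  mu.-integrable A (EFin \o (fun t => contrast_factor tau x t * prior_kernel L t)).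
Proof.
move=> mA AD; apply: (@integrable_mul_prior_kernel _ _ (expR (x ^+ 2 / 4))) => //.
  by apply: measurable_funS (measurable_contrast_factor tau x).
by move=> t /AD /=; rewrite in_itv/= andbT => /(normr_contrast_factor_le tau x).
Qed.

Lemma contrast_homo tau x y : `|x| <= `|y| -> contrast L tau x <= contrast L tau y.
Proof.
move=> xy; apply: le_Rintegral => //; [exact: integrable_contrast..|].
move=> t /=; rewrite in_itv/= andbT => t0.
by rewrite ler_pM2r ?prior_kernel_gt0// contrast_factor_homo.
Qed.

Lemma posterior_shrinkage_gt_half tau x :
  (2^-1 < posterior_shrinkage 2^-1 L tau x) = (0 < contrast L tau x).
Proof.
set D : set R := `]0, +oo[%classic.
have mD : measurable D by exact: measurable_itv.
(* The likelihood factor, kept apart from the prior: being at most 1, it is integrable against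
   [prior_kernel]. *)
pose k t := damping tau t * expR (- (x ^+ 2 / (2 * (1 + t * tau ^+ 2)))).
have kE t : posterior_weight 2^-1 L tau x t = k t * prior_kernel L t.
  by rewrite /posterior_weight /k /prior_kernel /damping !mulrA.
pose r t := t * tau ^+ 2 / (1 + t * tau ^+ 2).
have rE t : 0 < t -> r t = (shrink_gap tau t + 1) / 2.
  by move=> t0; rewrite /r /shrink_gap; field; rewrite gt_eqF ?one_plus_gt0.
have kgE t : 0 < t -> k t = expR (- (x ^+ 2 / 4)) *
    (damping tau t * expR (x ^+ 2 / 4 * shrink_gap tau t)).
  move=> t0; rewrite /k (_ : - (x ^+ 2 / (2 * _)) =
    - (x ^+ 2 / 4) + x ^+ 2 / 4 * shrink_gap tau t); first by rewrite expRD; ring.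
  by rewrite /shrink_gap; field; rewrite gt_eqF ?one_plus_gt0.
have mg := measurable_shrink_gap tau.
have mk : measurable_fun D k.
  apply: (eq_measurable_fun (fun t => expR (- (x ^+ 2 / 4)) *
    (damping tau t * expR (x ^+ 2 / 4 * shrink_gap tau t)))).
    by move=> t; rewrite inE/D/= in_itv/= andbT => /kgE.
  apply: measurable_funM => //; apply: measurable_funM.
    exact: measurable_damping.
  by apply: measurableT_comp => //; exact: measurable_funM.
have mr : measurable_fun D r.
  apply: (eq_measurable_fun (fun t => (shrink_gap tau t + 1) / 2)).
    by move=> t; rewrite inE/D/= in_itv/= andbT => /rE.
  by apply: measurable_funM => //; exact: measurable_funD.
have k0 t : 0 < t -> 0 <= k t <= 1.
  move=> t0; rewrite mulr_ge0 ?expR_ge0 ?(ltW (damping_gt0 _ _ _))//=.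
  rewrite mulr_ile1 ?expR_ge0 ?(ltW (damping_gt0 _ _ _)) ?damping_le1//.
  rewrite expR_le1 oppr_le0 divr_ge0 ?sqr_ge0// mulr_ge0// ltW//.
  exact: one_plus_gt0.
have r0 t : 0 < t -> 0 <= r t <= 1.
  move=> t0; have := normr_shrink_gap_le1 tau t t0; rewrite rE// ler_norml.
  by move=> /andP[? ?]; apply/andP; split; lra.
have iw : mu.-integrable D (EFin \o (fun t => k t * prior_kernel L t)).
  apply: (@integrable_mul_prior_kernel _ _ 1) => // t.
  by rewrite /D/= in_itv/= andbT => /k0/andP[? ?]; rewrite ger0_norm.
have irw : mu.-integrable D (EFin \o (fun t => r t * (k t * prior_kernel L t))).
  rewrite (_ : (fun t => _) = (fun t => (r t * k t) * prior_kernel L t)); last first.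
    by apply/funext => t; rewrite mulrA.
  apply: (@integrable_mul_prior_kernel _ _ 1) => //; first exact: measurable_funM.
  move=> t; rewrite /D/= in_itv/= andbT => t0.
  have /andP[? ?] := k0 _ t0; have /andP[? ?] := r0 _ t0.
  by rewrite normrM !ger0_norm// mulr_ile1.
have -> : posterior_shrinkage 2^-1 L tau x =
    \int[mu]_(t in D) (r t * (k t * prior_kernel L t)) /
    \int[mu]_(t in D) (k t * prior_kernel L t).
  rewrite /posterior_shrinkage; congr (_ / _); apply: eq_Rintegral => t _.
    by rewrite kE.
  by rewrite kE.
have -> : contrast L tau x = expR (x ^+ 2 / 4) *
    (2 * \int[mu]_(t in D) (r t * (k t * prior_kernel L t)) -
     \int[mu]_(t in D) (k t * prior_kernel L t)).
  have i2 : mu.-integrable D (EFin \o (fun t => 2 * (r t * (k t * prior_kernel L t)))).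
    by have := @integrableZl _ _ _ mu D (measurable_itv _) 2 _ irw.
  rewrite -RintegralZl// -RintegralB// -RintegralZl//; last first.
    by have := @integrableB _ _ _ mu D (measurable_itv _) _ _ i2 iw.
  apply: eq_Rintegral => t; rewrite inE/D/= in_itv/= andbT => t0.
  rewrite -posterior_weightE// kE rE//; congr (_ * _).
  by field.
rewrite pmulr_rgt0 ?expR_gt0// subr_gt0.
(* When W = 0 the quotient N / W is 0 by convention, and N <= W, so the positivity of
   W is not needed. *)
set N := \int[mu]_(t in D) (r t * _); set W := \int[mu]_(t in D) _.
have W0 : 0 <= W.
  apply: Rintegral_ge0 => t; rewrite /D/= in_itv/= andbT => t0.
  by rewrite mulr_ge0 ?(ltW (prior_kernel_gt0 _ _))//; have /andP[] := k0 _ t0.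
have NW : N <= W.
  apply: le_Rintegral => // t; rewrite /D/= in_itv/= andbT => t0.
  have /andP[? ?] := k0 _ t0; have /andP[? ?] := r0 _ t0.
  by rewrite ler_piMl// mulr_ge0 ?(ltW (prior_kernel_gt0 _ _)).
have [Wp|] := ltP 0 W; first by rewrite ltr_pdivlMr// mulrC ltr_pdivrMr// mulrC.
move=> W0'; have -> : W = 0 by apply/le_anti; rewrite W0 W0'.
rewrite invr0 mulr0; apply/idP/idP => [|]; first by rewrite ltNge invr_ge0 ler0n.
by move: NW W0 W0'; lra.
Qed.

End Integrability.
End ShrinkageContrast.

(** * Bounds on the contrast and on the critical value *)

Section Thresholds.
Context {R : realType}.
Notation mu := (@lebesgue_measure R).
Implicit Types (tau x t : R).

Lemma Rintegral_ge_box (f : R -> R) (D : set R) (a b c : R) :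
  measurable D -> mu.-integrable D (EFin \o f) -> (forall t, D t -> 0 <= f t) ->
  a <= b -> 0 <= c -> `[a, b] `<=` D -> (forall t, a <= t <= b -> c <= f t) ->
  c * (b - a) <= \int[mu]_(t in D) f t.
Proof.
move=> mD fi f0 ab c0 abD cf.
rewrite -lee_fin /Rintegral fineK; last exact: integrable_fin_num.
have mf : measurable_fun D (EFin \o f) by case/integrableP : fi.
apply: (@le_trans _ _ (\int[mu]_(t in `[a, b]) (f t)%:E)%E); last first.
  by apply: ge0_subset_integral => //= t Dt; rewrite lee_fin f0.
apply: (@le_trans _ _ (\int[mu]_(t in `[a, b]) cst c%:E t)%E).
  rewrite integral_cst//= lebesgue_measure_itv/= lte_fin.
  case: ltP => [_|ba]; first by rewrite -EFinB -EFinM.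
  by rewrite mule0 lee_fin mulr_ge0_le0// subr_le0.
apply: ge0_le_integral => //.
exact: measurable_funS mf.
Qed.

Variables (L : R -> R) (K : R).
Hypothesis hprior : one_group_prior K 2^-1 L.
Variables (c0 t0 M : R).
Hypotheses (c0_gt0 : 0 < c0) (t0_gt0 : 0 < t0) (M_gt0 : 0 < M).
Hypothesis L_ge : forall t, t0 <= t -> c0 <= L t.
Hypothesis L_le : forall t, 0 < t -> L t <= M.

Let g := prior_kernel L.

(** The bound [L <= M] reduces the tail to that of t^(-3/2). *)
Lemma prior_kernel_tail_le (A : set R) (a : R) : 0 < a ->
  measurable A -> A `<=` `[a, +oo[ -> \int[mu]_(t in A) g t <= M * (2 / Num.sqrt a).
Proof.
move=> a0 mA Aa.
have A0 : A `<=` `]0, +oo[.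
  move=> t /Aa/=; rewrite !in_itv/= !andbT; exact: lt_le_trans.
have gi : mu.-integrable A (EFin \o g).
  exact: integrableS (integrable_prior_kernel _ _ hprior).
have a0D : `[a, +oo[ `<=` (`]0, +oo[ : set R).
  by move=> t /=; rewrite !in_itv/= !andbT; exact: lt_le_trans.
have mp (B : set R) : measurable_fun B (fun t : R => t `^ (- 2^-1 - 1)).
  by apply: measurable_funTS; exact: measurable_powR.
rewrite -lee_fin /Rintegral fineK; last exact: integrable_fin_num.
rewrite EFinM -integral_powR_neg3half// -ge0_integralZl_EFin//; last 3 first.
- by move=> t _; rewrite lee_fin powR_ge0.
- by apply/measurable_EFinP; exact: mp.
- exact: ltW.
apply: (@le_trans _ _ (\int[mu]_(t in `[a, +oo[) (g t)%:E)%E).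
  apply: ge0_subset_integral => //.
    apply/measurable_EFinP; apply: measurable_funS a0D _ => //.
    exact: measurable_prior_kernel hprior.
  move=> t /a0D/=; rewrite in_itv/= andbT => tp.
  by rewrite lee_fin ltW// (prior_kernel_gt0 _ _ hprior).
apply: ge0_le_integral => //.
- move=> t /a0D/=; rewrite in_itv/= andbT => tp.
  by rewrite lee_fin ltW// (prior_kernel_gt0 _ _ hprior).
- apply/measurable_EFinP; apply: measurable_funS a0D _ => //.
  exact: measurable_prior_kernel hprior.
- apply/measurable_EFinP; apply: measurable_funM; [exact: measurable_cst|exact: mp].
- move=> t /a0D/=; rewrite in_itv/= andbT => tp.
  by rewrite -EFinM lee_fin /g /prior_kernel mulrC ler_wpM2r ?powR_ge0// L_le.
Qed.

Lemma contrast_split tau x (T : R) : 0 < T ->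
  contrast L tau x =
    \int[mu]_(t in `]0, T]) (contrast_factor tau x t * g t) +
    \int[mu]_(t in `]T, +oo[) (contrast_factor tau x t * g t).
Proof.
move=> T0; rewrite /contrast -Rintegral_setU//.
- by rewrite -itv_bndbnd_setU// bnd_simp ltW.
- rewrite -itv_bndbnd_setU// ?bnd_simp ?ltW//.
  exact: (integrable_contrast _ _ hprior).
- rewrite disj_set2E; apply/eqP/seteqP; split => // t [] /=.
  rewrite !in_itv/= andbT => /andP[_ tT] Tt.
  by move: (le_lt_trans tT Tt); rewrite ltxx.
Qed.

Lemma prior_kernel_ge t b : t0 <= t -> t <= b -> (b * Num.sqrt b)^-1 * c0 <= g t.
Proof.
move=> tt tb; have tp : 0 < t by exact: lt_le_trans tt.
have bp : 0 < b by exact: lt_le_trans tb.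
rewrite /g /prior_kernel powR_neg3half// ler_pM ?(ltW c0_gt0) ?L_ge//.
  by rewrite invr_ge0 mulr_ge0 ?sqrtr_ge0// ltW.
rewrite lef_pV2 ?posrE ?mulr_gt0 ?sqrtr_gt0//.
by rewrite ler_pM ?sqrtr_ge0 ?(ltW tp)// ler_wsqrtr.
Qed.

(** Up to t = tau^-2 the contrast factor is nonpositive. Beyond, it contributes at most exp(x^2/4)
    times the prior tail, which is O(tau), while the interval from t0 to t0 + 1, where L >= c0,
    alone contributes a negative amount of order exp(-x^2/4). A positive total forces the former to
    exceed the latter. *)
Lemma contrast_gt0_tail_bound : exists A tau0 : R, [/\ 0 < A, 0 < tau0 &
  forall tau x, 0 < tau -> tau <= tau0 -> 0 < contrast L tau x ->
    expR (- (x ^+ 2 / 2)) <= A * tau].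
Proof.
have [b bE] : exists b, b = t0 + 1 by exists (t0 + 1).
have b0 : 0 < b by rewrite bE addr_gt0.
set g0 := (b * Num.sqrt b)^-1 * c0.
have g0_gt0 : 0 < g0 by rewrite mulr_gt0// invr_gt0 mulr_gt0// sqrtr_gt0.
(* Here 12 = 2 * 6: the prior tail is at most 2 M tau, and on the box the gap is at most -1/3 and
   the damping at least 1/2, because the bound on [tau] gives u <= 1/2 there. *)
exists (12 * M / g0), (Num.sqrt (2 * b))^-1; split.
- by rewrite divr_gt0// mulr_gt0.
- by rewrite invr_gt0 sqrtr_gt0; lra.
move=> tau x tau_gt0 tau_le; set T := (tau ^+ 2)^-1.
have T0 : 0 < T by rewrite invr_gt0 exprn_gt0.
have T2b : b * tau ^+ 2 <= 2^-1.
  have s0 : 0 < Num.sqrt (2 * b) by rewrite sqrtr_gt0; lra.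
  have : tau ^+ 2 <= (Num.sqrt (2 * b))^-1 ^+ 2.
    by rewrite lerXn2r// nnegrE ?invr_ge0 ?(ltW s0)// ltW.
  rewrite exprVn sqr_sqrtr; last by lra.
  by rewrite -(ler_pM2l b0) => /le_trans -> //; rewrite invfM mulrCA divff ?gt_eqF// mulr1.
have sT : Num.sqrt T = tau^-1 by rewrite /T -exprVn sqrtr_sqr ger0_norm// invr_ge0 ltW.
have bT : b <= T.
  rewrite -[T]mul1r ler_pdivlMr ?exprn_gt0//; apply: le_trans T2b _.
  by rewrite invf_le1// ler1n.
have I1 : \int[mu]_(t in `]T, +oo[) (contrast_factor tau x t * g t) <=
    expR (x ^+ 2 / 4) * (M * (2 * tau)).
  have TD : `]T, +oo[ `<=` (`]0, +oo[ : set R).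
    by move=> t /=; rewrite !in_itv/= !andbT; exact: lt_trans.
  apply: (@le_trans _ _ (\int[mu]_(t in `]T, +oo[) (expR (x ^+ 2 / 4) * g t))).
    apply: le_Rintegral => //.
    - exact: (integrable_contrast _ _ hprior).
    - apply: (integrable_mul_prior_kernel _ _ hprior _ _ (expR (x ^+ 2 / 4))) => // t _.
      by rewrite ger0_norm ?expR_ge0.
    move=> t /TD /=; rewrite in_itv/= andbT => tp.
    rewrite ler_wpM2r ?(ltW (prior_kernel_gt0 _ _ hprior _ _))//.
    by rewrite (le_trans (ler_norm _))// normr_contrast_factor_le.
  rewrite RintegralZl//; last exact: integrableS (integrable_prior_kernel _ _ hprior).
  rewrite ler_pM2l ?expR_gt0//.
  apply: (le_trans (@prior_kernel_tail_le _ T T0 _ _)) => //.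
    by move=> t /=; rewrite !in_itv/= !andbT => /ltW.
  by rewrite sT invrK.
have iT : mu.-integrable (`]0%R, T] : set R)
    (EFin \o (fun t => contrast_factor tau x t * g t)).
  apply: (integrable_contrast _ _ hprior) => // t /=.
  by rewrite !in_itv/= !andbT => /andP[].
have I0 : 6^-1 * expR (- (x ^+ 2 / 4)) * g0 * (b - t0) <=
    \int[mu]_(t in `]0, T]) (- 1 * (contrast_factor tau x t * g t)).
  apply: Rintegral_ge_box => //.
  - by have := @integrableZl _ _ _ mu `]0%R, T]%classic (measurable_itv _) (- 1) _ iT.
  - move=> t /=; rewrite in_itv/= => /andP[tp tT].
    rewrite mulN1r oppr_ge0 mulr_le0_ge0 ?(ltW (prior_kernel_gt0 _ _ hprior _ _))//.
    rewrite /contrast_factor mulr_le0_ge0 ?(ltW (damping_gt0 _ _ _))//.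
    rewrite mulr_le0_ge0 ?expR_ge0// shrink_gapE// mulr_le0_ge0//.
      by rewrite subr_le0 -(ler_pM2r T0) /T mulfK ?mul1r// gt_eqF// exprn_gt0.
    by rewrite invr_ge0 ltW// one_plus_gt0.
  - lra.
  - by rewrite mulr_ge0 ?(ltW g0_gt0)// mulr_ge0 ?expR_ge0.
  - move=> t /=; rewrite !in_itv/= => /andP[t0t tb].
    by rewrite (lt_le_trans t0_gt0 t0t) (le_trans tb bT).
  move=> t /andP[t0t tb]; have tp : 0 < t by exact: lt_le_trans t0t.
  have u_le : t * tau ^+ 2 <= 2^-1.
    by apply: le_trans T2b; rewrite ler_wpM2r// sqr_ge0.
  have u0 := one_plus_gt0 tau t tp.
  have u_ge : 0 <= t * tau ^+ 2 by rewrite mulr_ge0 ?sqr_ge0// ltW.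
  rewrite mulN1r -[leRHS]mulNr /contrast_factor ler_pM//.
  - exact: ltW.
  - rewrite -[leRHS]mulNr -[X in _ <= X * _]mulNr.
    have gap : 3^-1 <= - shrink_gap tau t.
      rewrite shrink_gapE// -mulNr ler_pdivlMr//; lra.
    have damp : 2^-1 <= damping tau t.
      rewrite dampingE// lef_pV2 ?posrE ?sqrtr_gt0//.
      rewrite -[leRHS](@ger0_norm _ 2)// -sqrtr_sqr ler_wsqrtr//; lra.
    have ex : expR (- (x ^+ 2 / 4)) <= expR (x ^+ 2 / 4 * shrink_gap tau t).
      rewrite ler_expR -mulrN1 ler_wpM2l ?divr_ge0 ?sqr_ge0//.
      by have := normr_shrink_gap_le1 tau t tp; rewrite ler_norml => /andP[].
    have e0 := expR_gt0 (- (x ^+ 2 / 4)).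
    rewrite (_ : 6^-1 * _ = 3^-1 * expR (- (x ^+ 2 / 4)) * 2^-1); last by field.
    by rewrite ler_pM ?mulr_ge0 ?expR_ge0 ?invr_ge0// ler_pM ?expR_ge0 ?invr_ge0.
  - exact: prior_kernel_ge.
rewrite (contrast_split _ _ T)// => I_gt0.
move: I0; rewrite RintegralZl//.
rewrite mulN1r (_ : b - t0 = 1) ?mulr1; last by rewrite bE; ring.
move=> I0.
have : 6^-1 * expR (- (x ^+ 2 / 4)) * g0 <= expR (x ^+ 2 / 4) * (M * (2 * tau)).
  by move: I0 I1 I_gt0; lra.
rewrite (_ : x ^+ 2 / 2 = x ^+ 2 / 4 + x ^+ 2 / 4); last by field.
rewrite opprD expRD; set y := expR (- _).
have y0 : 0 < y by exact: expR_gt0.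
have -> : expR (x ^+ 2 / 4) = y^-1 by rewrite /y expRN invrK.
move=> H; rewrite mulrAC ler_pdivlMr//.
have : y * (6^-1 * y * g0) <= y * (y^-1 * (M * (2 * tau))) by rewrite ler_pM2l.
rewrite (mulrA y y^-1) divff ?gt_eqF// mul1r.
by lra.
Qed.


(** The gap lies between -1 and 0 and the damping is at most 1, so only the exponential has to be
    controlled. *)
Lemma contrast_factor_ge tau x t e : 0 < t -> shrink_gap tau t <= 0 ->
  expR (x ^+ 2 / 4 * shrink_gap tau t) <= e -> - e <= contrast_factor tau x t.
Proof.
move=> tp gap0 ele; rewrite lerNl /contrast_factor -mulNr -mulNr.
have := normr_shrink_gap_le1 tau t tp; rewrite ler0_norm// => gap1.
rewrite -[leRHS]mulr1 ler_pM ?damping_le1 ?(ltW (damping_gt0 _ _ _))//.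
  by rewrite mulr_ge0 ?expR_ge0// oppr_ge0.
by rewrite -[leRHS]mul1r ler_pM ?expR_ge0// oppr_ge0.
Qed.

(** The gain is collected at u of order x^2. There the exponent x^2 h / 4 is within 1/2 of its
    supremum x^2/4; a much smaller u loses an exponential factor, and a larger one has less prior
    mass. The prior mass of this range is at least of order tau / x and the damping of order 1 / x,
    whence tau exp(x^2/4) / x^2. The mass near 0 costs O(exp(-x^2/4)), and the middle range O(x
    tau), which the exponential in the gain outgrows. *)
Lemma contrast_gt0_of_large : exists B x0 tau1 : R, [/\ 0 < B, 0 < x0, 0 < tau1 &
  forall tau x, 0 < tau -> tau <= tau1 -> x0 <= x ->
    B * x ^+ 2 < tau * expR (x ^+ 2 / 2) -> 0 < contrast L tau x].
Proof.
have [_ _ _ _ [K0 _]] := hprior.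
have M0 := M_gt0.
have le_4_of_le (u v : R) : 4 <= v -> u <= 2 * v -> 1 + u <= 2 ^+ 2 * v by lra.
have gap_ge_half (v w : R) : v <= 4^-1 -> 1 - 2 * v <= w -> 2^-1 <= w by lra.
have two_le_sqr : 2 <= 2 ^+ 2 :> R by lra.
have sum3_gt0 (B1 B2 C I1 I2 I3 : R) : - B1 <= I1 -> - B2 <= I2 -> C <= I3 ->
  B1 < 2^-1 * C -> B2 <= 2^-1 * C -> 0 < I1 + I2 + I3 by lra.
(* Here 32 = 2 * 2 * 8, from a gap of at least 1/2, a damping of at least 1 / (2 x) and t^(-3/2) >=
   (tau / (2 x))^3; exp(-1/2) is the loss in the exponent. *)
have [c2 c2E] : exists c2, c2 = c0 * expR (- 2^-1) / 32 by eexists.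
have c2_gt0 : 0 < c2 by rewrite c2E divr_gt0// mulr_gt0 ?expR_gt0.
(* The first constant makes the region near 0 cost less than half of the gain. The second makes the
   middle region cost at most half: 256 = 4 * 64, where exp(x^2/4) >= x^4/64. The third ensures t0
   <= tau^-2. *)
exists (2 * expR 2^-1 / (K * c2)), (2 + 256 * M / c2), (Num.sqrt t0)^-1; split.
- by rewrite divr_gt0 ?mulr_gt0 ?expR_gt0.
- by rewrite addr_gt0// divr_gt0// mulr_gt0.
- by rewrite invr_gt0 sqrtr_gt0.
move=> tau x tau_gt0 tau_le x_ge HB.
have [T TE] : exists T, T = (tau ^+ 2)^-1 by eexists.
have tau2_gt0 : 0 < tau ^+ 2 by rewrite exprn_gt0.
have T0 : 0 < T by rewrite TE invr_gt0.
have Ttau : T * tau ^+ 2 = 1 by rewrite TE mulVf// gt_eqF.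
have x2 : 2 <= x by apply: le_trans x_ge; rewrite lerDl divr_ge0 ?mulr_ge0 ?ltW.
have x_gt0 : 0 < x by rewrite (lt_le_trans _ x2).
have xx_gt0 : 0 < x ^+ 2 by rewrite exprn_gt0.
have xx4 : 4 <= x ^+ 2 by rewrite expr2; nra.
(* The cut u = 1/x^2: below it the exponent is at most 1/2 - x^2/4, a constant factor away from the
   value at u = 0. *)
have [a aE] : exists a, a = T / x ^+ 2 by eexists.
have a0 : 0 < a by rewrite aE divr_gt0.
have atau : a * tau ^+ 2 = (x ^+ 2)^-1 by rewrite aE mulrAC Ttau mul1r.
have aT : a <= T by rewrite aE ler_piMr ?(ltW T0)// invf_le1//; lra.
have t0T : t0 <= T.
  have s0 : 0 < Num.sqrt t0 by rewrite sqrtr_gt0.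
  have : tau ^+ 2 <= t0^-1.
    rewrite -[in leRHS](@sqr_sqrtr _ t0) ?(ltW t0_gt0)// -exprVn.
    by rewrite lerXn2r// nnegrE ?invr_ge0 ?(ltW s0)// ltW.
  by rewrite TE -[X in _ <= X]mul1r ler_pdivlMr// -ler_pdivlMl// mulr1.
have gap_le0 t : 0 < t -> t <= T -> shrink_gap tau t <= 0.
  move=> tp tT; rewrite shrink_gapE// mulr_le0_ge0//; last first.
    by rewrite invr_ge0 ltW// one_plus_gt0.
  by rewrite subr_le0 -Ttau ler_pM2r.
have D1 : `]0, a] `<=` (`]0, +oo[ : set R).
  by move=> t /=; rewrite !in_itv/= !andbT => /andP[].
have D2 : `]a, T] `<=` (`]0, +oo[ : set R).
  by move=> t /=; rewrite !in_itv/= !andbT => /andP[/(lt_trans a0)].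
have D3 : `]T, +oo[ `<=` (`]0, +oo[ : set R).
  by move=> t /=; rewrite !in_itv/= !andbT; exact: lt_trans.
have D12 : `]0, T] `<=` (`]0, +oo[ : set R).
  by move=> t /=; rewrite !in_itv/= !andbT => /andP[].
have i1 : mu.-integrable (`]0%R, a] : set R)
    (EFin \o (fun t => contrast_factor tau x t * g t)).
  exact: (integrable_contrast _ _ hprior).
have i2 : mu.-integrable (`]a, T] : set R)
    (EFin \o (fun t => contrast_factor tau x t * g t)).
  exact: (integrable_contrast _ _ hprior).
have i3 : mu.-integrable (`]T, +oo[ : set R)
    (EFin \o (fun t => contrast_factor tau x t * g t)).
  exact: (integrable_contrast _ _ hprior).
have i12 : mu.-integrable (`]0%R, T] : set R)
    (EFin \o (fun t => contrast_factor tau x t * g t)).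
  exact: (integrable_contrast _ _ hprior).
have gi (A : set R) : measurable A -> A `<=` `]0, +oo[ ->
    mu.-integrable A (EFin \o g).
  by move=> mA AD; exact: integrableS (integrable_prior_kernel _ _ hprior).
(* The contrast is bounded below separately on u <= 1/x^2, on 1/x^2 < u <= 1 and on
   u > 1, where x^2 <= u <= 2 x^2 alone suffices. *)
have split12 : \int[mu]_(t in `]0, T]) (contrast_factor tau x t * g t) =
    \int[mu]_(t in `]0, a]) (contrast_factor tau x t * g t) +
    \int[mu]_(t in `]a, T]) (contrast_factor tau x t * g t).
  have U : `]0, T]%classic = `]0, a]%classic `|` `]a, T]%classic :> set R.
    by rewrite -itv_bndbnd_setU// bnd_simp ltW.
  rewrite U Rintegral_setU// -?U//.
  rewrite disj_set2E; apply/eqP/seteqP; split => // t [] /=.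
  rewrite !in_itv/= => /andP[_ ta] /andP[at_ _].
  by move: (le_lt_trans ta at_); rewrite ltxx.
have [e1 e1E] : exists e1, e1 = expR (2^-1 - x ^+ 2 / 4) by eexists.
have e1_gt0 : 0 < e1 by rewrite e1E expR_gt0.
have I1 : - e1 * K^-1 <=
    \int[mu]_(t in `]0, a]) (contrast_factor tau x t * g t).
  apply: (@le_trans _ _ (\int[mu]_(t in `]0, a]) (- e1 * g t))).
    rewrite RintegralZl//; last exact: gi.
    rewrite ler_nM2l ?oppr_lt0//.
    rewrite -lee_fin -(integral_prior_kernel _ _ hprior) /Rintegral fineK; last first.
      exact: integrable_fin_num (gi _ _ _).
    apply: ge0_subset_integral => //.
      by apply/measurable_EFinP; exact: measurable_prior_kernel hprior.
    move=> t /=; rewrite in_itv/= andbT => tp.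
    by rewrite lee_fin ltW// (prior_kernel_gt0 _ _ hprior).
  apply: le_Rintegral => //.
    by have := @integrableZl _ _ _ mu `]0%R, a]%classic (measurable_itv _) (- e1) _
      (gi _ (measurable_itv _) D1).
  move=> t /[dup] /D1 /=; rewrite !in_itv/= andbT => tp /andP[_ ta].
  rewrite ler_wpM2r ?(ltW (prior_kernel_gt0 _ _ hprior _ _))//.
  apply: contrast_factor_ge => //; first exact/gap_le0/(le_trans ta).
  rewrite e1E ler_expR.
  have u0 := one_plus_gt0 tau t tp.
  have ut : t * tau ^+ 2 <= (x ^+ 2)^-1 by rewrite -atau ler_pM2r.
  have up : 0 <= t * tau ^+ 2 by rewrite mulr_ge0 ?ltW.
  have gap2 : shrink_gap tau t <= 2 * (x ^+ 2)^-1 - 1.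
    apply: (@le_trans _ _ (2 * (t * tau ^+ 2) - 1)); last by lra.
    by rewrite shrink_gapE// ler_pdivrMr//; nra.
  apply: (@le_trans _ _ (x ^+ 2 / 4 * (2 * (x ^+ 2)^-1 - 1))).
    by rewrite ler_wpM2l// divr_ge0// ltW.
  by rewrite [leLHS](_ : _ = 2^-1 - x ^+ 2 / 4)//; field; rewrite gt_eqF.
have I2 : - (M * (2 * (x * tau))) <=
    \int[mu]_(t in `]a, T]) (contrast_factor tau x t * g t).
  have sa : Num.sqrt a = (x * tau)^-1.
    rewrite aE TE -invfM -exprMn -exprVn sqrtr_sqr mulrC.
    by rewrite ger0_norm// invr_ge0 mulr_ge0// ltW.
  apply: (@le_trans _ _ (\int[mu]_(t in `]a, T]) (- 1 * g t))).
    rewrite RintegralZl//; last exact: gi.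
    rewrite mulN1r lerN2 (_ : x * tau = (Num.sqrt a)^-1); last by rewrite sa invrK.
    apply: prior_kernel_tail_le => //.
    by move=> t /=; rewrite !in_itv/= => /andP[/ltW ->].
  apply: le_Rintegral => //.
    by have := @integrableZl _ _ _ mu `]a, T]%classic (measurable_itv _) (- 1) _
      (gi _ (measurable_itv _) D2).
  move=> t /[dup] /D2 /=; rewrite !in_itv/= andbT => tp /andP[_ tT].
  rewrite ler_wpM2r ?(ltW (prior_kernel_gt0 _ _ hprior _ _))//.
  apply: contrast_factor_ge => //; first exact: gap_le0.
  by rewrite expR_le1 mulr_ge0_le0 ?gap_le0// divr_ge0// ltW.
have [y yE] : exists y, y = expR (x ^+ 2 / 4) by eexists.
have y_gt0 : 0 < y by rewrite yE expR_gt0.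
have I3 : c2 * y * tau / x ^+ 2 <=
    \int[mu]_(t in `]T, +oo[) (contrast_factor tau x t * g t).
  (* The square of [z] is 4 T x^2, an upper bound for the points of the box whose square root is
     explicit. *)
  have [z zE] : exists z, z = 2 * x / tau by eexists.
  have z0 : 0 < z by rewrite zE divr_gt0// mulr_gt0.
  have [c cE] : exists c, c = 2^-1 * (y * expR (- 2^-1)) * (2 * x)^-1 *
    ((z ^+ 2 * z)^-1 * c0) by eexists.
  have -> : c2 * y * tau / x ^+ 2 = c * (2 * T * x ^+ 2 - T * x ^+ 2).
    by rewrite cE zE c2E TE; field; rewrite !gt_eqF.
  have Tx : T < T * x ^+ 2 by rewrite ltr_pMr// (lt_le_trans _ xx4)// ltr1n.
  have D4 : `[T * x ^+ 2, 2 * T * x ^+ 2] `<=` (`]T, +oo[ : set R).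
    move=> t /=; rewrite !in_itv/= andbT => /andP[Tt _]; exact: lt_le_trans Tt.
  have gap_half t : T * x ^+ 2 <= t -> 1 - 2 / x ^+ 2 <= shrink_gap tau t.
    move=> Tt; rewrite /shrink_gap lerD2l lerN2 ler_wpM2l//.
    rewrite lef_pV2 ?posrE//; last by rewrite one_plus_gt0// (lt_le_trans _ Tt)// mulr_gt0.
    apply: (@le_trans _ _ (t * tau ^+ 2)); last by rewrite lerDr.
    by apply: le_trans (ler_wpM2r (ltW tau2_gt0) Tt); rewrite mulrAC Ttau mul1r.
  apply: Rintegral_ge_box => //.
  - move=> t /[dup] /D3 /=; rewrite !in_itv/= !andbT => tp Tt.
    rewrite mulr_ge0 ?(ltW (prior_kernel_gt0 _ _ hprior _ _))//.
    rewrite mulr_ge0 ?(ltW (damping_gt0 _ _ _))// mulr_ge0 ?expR_ge0//.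
    rewrite shrink_gapE// divr_ge0 ?(ltW (one_plus_gt0 _ _ _))//.
    by rewrite subr_ge0 -Ttau ler_pM2r// ltW.
  - by rewrite ler_pM2r// ler_peMl ?ltW// ltr1n.
  - by rewrite cE ltW// !mulr_gt0 ?expR_gt0 ?invr_gt0 ?mulr_gt0 ?exprn_gt0.
  move=> t /andP[Tt tT].
  have tp : 0 < t by rewrite (lt_le_trans _ Tt)// mulr_gt0.
  have u0 := one_plus_gt0 tau t tp.
  have gh := gap_half t Tt.
  have xV : (x ^+ 2)^-1 <= 4^-1 by rewrite lef_pV2 ?posrE.
  rewrite cE /contrast_factor ler_pM//.
  - by rewrite ltW// !mulr_gt0 ?expR_gt0 ?invr_gt0 ?mulr_gt0.
  - by rewrite ltW// mulr_gt0 ?invr_gt0 ?mulr_gt0 ?exprn_gt0.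
  - have ex : y * expR (- 2^-1) <= expR (x ^+ 2 / 4 * shrink_gap tau t).
      rewrite yE -expRD ler_expR.
      apply: (@le_trans _ _ (x ^+ 2 / 4 * (1 - 2 / x ^+ 2))).
        by rewrite [leRHS](_ : _ = x ^+ 2 / 4 - 2^-1)//; field; rewrite gt_eqF.
      by rewrite ler_wpM2l// divr_ge0// ltW.
    have damp : (2 * x)^-1 <= damping tau t.
      have x2_gt0 : 0 < 2 * x by rewrite mulr_gt0.
      rewrite dampingE// lef_pV2 ?posrE ?sqrtr_gt0//.
      rewrite -[leRHS]ger0_norm ?(ltW x2_gt0)// -sqrtr_sqr ler_wsqrtr//.
      have : t * tau ^+ 2 <= 2 * x ^+ 2.
        apply: (le_trans (ler_wpM2r (ltW tau2_gt0) tT)).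
        by rewrite mulrAC -(mulrA 2) Ttau mulr1.
      by rewrite exprMn; exact: le_4_of_le.
    apply: ler_pM => //.
      by rewrite ltW// !mulr_gt0 ?expR_gt0 ?invr_gt0.
      by rewrite ltW// invr_gt0 mulr_gt0.
    apply: ler_pM => //; first by rewrite ltW// mulr_gt0 ?expR_gt0.
    exact: gap_ge_half xV gh.
  - have tb : t <= z ^+ 2.
      rewrite (_ : z ^+ 2 = 2 ^+ 2 * T * x ^+ 2); last first.
        by rewrite zE TE; field; rewrite gt_eqF.
      by apply: (le_trans tT); rewrite !ler_pM2r.
    have -> : (z ^+ 2 * z)^-1 = (z ^+ 2 * Num.sqrt (z ^+ 2))^-1.
      by rewrite sqrtr_sqr ger0_norm// ltW.
    apply: prior_kernel_ge => //.
    by apply: le_trans Tt; apply: (le_trans t0T); exact: ltW.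
rewrite (contrast_split _ _ T)// split12.
have eE : e1 = expR 2^-1 / y by rewrite e1E expRD expRN yE.
have yyE : expR (x ^+ 2 / 2) = y * y.
  by rewrite yE -expRD; congr expR; field.
have y_ge : x ^+ 4 / 64 <= y.
  rewrite yE (_ : x ^+ 2 / 4 = x ^+ 2 / 8 + x ^+ 2 / 8); last by field.
  rewrite expRD; have := expR_ge1Dx (x ^+ 2 / 8).
  rewrite (_ : x ^+ 4 = x ^+ 2 * x ^+ 2); last by rewrite -exprD.
  set v := x ^+ 2 => h.
  apply: (@le_trans _ _ ((v / 8) * (v / 8))); first by rewrite [leRHS](_ : _ = v * v / 64)//; field.
  by rewrite ler_pM ?divr_ge0 ?sqr_ge0// (le_trans _ h)// lerDr.
have half1 : e1 / K < 2^-1 * (c2 * y * tau / x ^+ 2).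
  move: HB; rewrite yyE mulrAC ltr_pdivrMr ?mulr_gt0// eE => HB.
  rewrite mulrA ltr_pdivlMr// -(ltr_pM2r (mulr_gt0 y_gt0 K0)).
  rewrite (_ : _ * (y * K) = expR 2^-1 * x ^+ 2); last by field; rewrite !gt_eqF.
  rewrite -(@ltr_pM2l _ 2)// mulrA [ltRHS](_ : _ = tau * (y * y) * (K * c2)); last by field.
  by rewrite (mulrA 2).
have half2 : M * (2 * (x * tau)) <= 2^-1 * (c2 * y * tau / x ^+ 2).
  rewrite [leRHS]mulrA ler_pdivlMr//.
  have xM : 256 * M <= c2 * x.
    have : 256 * M / c2 <= x by apply: le_trans x_ge; rewrite lerDr.
    by rewrite ler_pdivrMr// (mulrC x).
  apply: (@le_trans _ _ (2^-1 * (c2 * (x ^+ 4 / 64) * tau))); last first.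
    by rewrite ler_pM2l// ler_pM2r// ler_pM2l.
  rewrite [leLHS](_ : _ = 256 * M * (x ^+ 3 * tau / 128)); last by field.
  rewrite [leRHS](_ : _ = c2 * x * (x ^+ 3 * tau / 128)); last by field.
  by rewrite ler_wpM2r// divr_ge0// mulr_ge0 ?exprn_ge0 ?ltW.
move: I1 I2 I3 half1 half2; rewrite mulNr; exact: sum3_gt0.
Qed.

End Thresholds.

(** * FDR and FNR at a fixed mean vector *)

Section BoundedExpectation.
Context {R : realType} {d : measure_display} {T : measurableType d}.
Variable P : probability T R.

(** A class stable under sums and products and contained in L^1; it contains all the statistics
    below and so settles their integrability. *)
Definition bounded_rv (f : T -> R) : Prop :=
  measurable_fun setT f /\ exists c : R, forall w, `|f w| <= c.

Lemma bounded_rv_integrable f : bounded_rv f -> P.-integrable setT (EFin \o f).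
Proof.
move=> [mf [c fc]]; apply: measurable_bounded_integrable => //.
  by rewrite -ge0_fin_numE// fin_num_measure.
exists c; split; first exact: num_real.
by move=> y cy t _; exact: le_trans (fc t) (ltW cy).
Qed.

Lemma bounded_rv_cst a : bounded_rv (fun=> a).
Proof. by split; [exact: measurable_cst|exists `|a|]. Qed.

Lemma bounded_rvD f g : bounded_rv f -> bounded_rv g ->
  bounded_rv (fun w => f w + g w).
Proof.
move=> [mf [c fc]] [mg [e ge]]; split; first exact: measurable_funD.
by exists (c + e) => w; rewrite (le_trans (ler_normD _ _))// lerD.
Qed.

Lemma bounded_rvM f g : bounded_rv f -> bounded_rv g ->
  bounded_rv (fun w => f w * g w).
Proof.
move=> [mf [c fc]] [mg [e ge]]; split; first exact: measurable_funM.
by exists (c * e) => w; rewrite normrM ler_pM.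
Qed.

Lemma bounded_rvB f g : bounded_rv f -> bounded_rv g ->
  bounded_rv (fun w => f w - g w).
Proof.
move=> [mf [c fc]] [mg [e ge]]; split; first exact: measurable_funB.
by exists (c + e) => w; rewrite (le_trans (ler_normB _ _))// lerD.
Qed.

Lemma bounded_rv_sum (I : Type) (s : seq I) (p : pred I) (f : I -> T -> R) :
  (forall i, bounded_rv (f i)) -> bounded_rv (fun w => \sum_(i <- s | p i) f i w).
Proof.
move=> bf; elim: s => [|i s IH].
  by under eq_fun do rewrite big_nil; exact: bounded_rv_cst.
under eq_fun do rewrite big_cons.
by case: (p i) => //; exact: bounded_rvD.
Qed.

Lemma Rintegral_sum (I : Type) (s : seq I) (p : pred I) (f : I -> T -> R) :
  (forall i, bounded_rv (f i)) ->
  \int[P]_w (\sum_(i <- s | p i) f i w) = \sum_(i <- s | p i) \int[P]_w f i w.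
Proof.
move=> bf; elim: s => [|i s IH].
  rewrite big_nil; under eq_Rintegral do rewrite big_nil.
  by rewrite Rintegral_cst// mul0r.
rewrite big_cons; under eq_Rintegral do rewrite big_cons.
case: (p i) => //; rewrite RintegralD ?IH//.
  exact: bounded_rv_integrable.
by apply: bounded_rv_integrable; exact: bounded_rv_sum.
Qed.

Lemma Rintegral_prob_cst (a : R) : \int[P]_w a = a.
Proof.
rewrite Rintegral_cst// (_ : (P : {measure set T -> \bar R}) setT = 1%E) ?mulr1//.
exact: probability_setT.
Qed.

End BoundedExpectation.

Section FixedMeans.
Context {R : realType} {n : nat} {d : measure_display} {T : measurableType d}.
Variables (P : probability T R) (eps : 'I_n -> {RV P >-> R}).
Hypothesis heps : iid_std_normal eps.
Variable phi : R -> bool.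
Hypothesis mphi : measurable [set x | phi x].
Notation gauss := (@normal_prob R 0 1).

(** The probability that a coordinate with mean [t] is rejected: the type I error at [t = 0], the
    power elsewhere. *)
Definition shifted_power (t : R) : R := fine (gauss [set z | phi (t + z)]).

Lemma measurable_shifted (t : R) : measurable [set z | phi (t + z)].
Proof.
have : measurable_fun setT (fun z : R => t + z) by exact: measurable_funD.
by move=> /(_ measurableT _ mphi); rewrite setTI.
Qed.

Lemma shifted_power_ge0 t : 0 <= shifted_power t.
Proof. exact: fine_gauss_ge0. Qed.

Lemma shifted_power_le1 t : shifted_power t <= 1.
Proof. by apply: fine_gauss_le1; exact: measurable_shifted. Qed.

Variable theta : 'rV[R]_n.

Let Y (i : 'I_n) (w : T) : R := (phi (theta ord0 i + eps i w))%:R.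
Let A (i : 'I_n) : set T := [set w | phi (theta ord0 i + eps i w)].
Let p (i : 'I_n) : R := shifted_power (theta ord0 i).

Let mA i : measurable (A i).
Proof.
have := measurable_funP (eps i) measurableT _ (measurable_shifted (theta ord0 i)).
by rewrite setTI.
Qed.

Let YE i : Y i = \1_(A i).
Proof.
apply/funext => w; rewrite /Y indicE; congr (_%:R).
by congr nat_of_bool; apply/idP/idP => [h|]; rewrite ?inE.
Qed.

Let bY i : bounded_rv (Y i).
Proof.
split; first by rewrite YE; exact: measurable_indic.
by exists 1 => w; rewrite /Y; case: phi; rewrite ?normr1 ?normr0.
Qed.

Let PA i : P (A i) = (p i)%:E.
Proof.
have [h _] := heps; rewrite /p /shifted_power fineK.
  by rewrite -(h i _ (measurable_shifted _)).
by apply: normal_prob_fin_num; exact: measurable_shifted.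
Qed.

Let EY i : \int[P]_w Y i w = p i.
Proof.
by rewrite /Rintegral YE integral_indic// setIT [X in fine X](PA i).
Qed.

Let PAA i j : i != j -> P (A i `&` A j) = (p i * p j)%:E.
Proof.
move=> ij; have [_ ind] := heps.
pose B k : set R := if k == i then [set z | phi (theta ord0 i + z)]
  else if k == j then [set z | phi (theta ord0 j + z)] else setT.
have mB k : measurable (B k).
  by rewrite /B; case: ifP => _; [|case: ifP => _ //]; exact: measurable_shifted.
have -> : A i `&` A j = [set w | forall k, B k (eps k w)].
  apply/seteqP; split => [w [wi wj] k|w h].
    by rewrite /B; case: eqP => [->//|_]; case: eqP => [->|].
  split; first by have := h i; rewrite /B eqxx.
  by have := h j; rewrite /B eqxx eq_sym (negbTE ij).
rewrite ind// (bigD1 i)//= (bigD1 j)/=; last by rewrite eq_sym.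
rewrite big1 ?mulr1.
  have -> : eps i @^-1` B i = A i by rewrite /B eqxx.
  have -> : eps j @^-1` B j = A j by rewrite /B eqxx eq_sym (negbTE ij).
  by rewrite !PA.
move=> k /andP[/negbTE ki /negbTE kj].
by rewrite /B ki kj preimage_setT probability_setT.
Qed.

Let EYY i j : i != j -> \int[P]_w (Y i w * Y j w) = p i * p j.
Proof.
move=> ij; under eq_Rintegral => w _ do rewrite !YE -[_ * _]/((\1_(A i) \* \1_(A j)) w) -indicI.
rewrite /Rintegral integral_indic//; last exact: measurableI.
by rewrite setIT [X in fine X](PAA i j ij).
Qed.

Let bYp i : bounded_rv (fun w => Y i w - p i).
Proof. by apply: bounded_rvB => //; exact: bounded_rv_cst. Qed.

(** Off the diagonal independence makes the covariance vanish; on the diagonal the square is at most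
    1. *)
Let cov i j : \int[P]_w ((Y i w - p i) * (Y j w - p j)) <= (i == j)%:R.
Proof.
have [<-|ij] := eqVneq i j.
  rewrite -[leRHS](Rintegral_prob_cst P); apply: le_Rintegral => //.
  - by apply: bounded_rv_integrable; exact: bounded_rvM.
  - by apply: bounded_rv_integrable; exact: bounded_rv_cst.
  move=> w _; have := shifted_power_ge0 (theta ord0 i).
  have := shifted_power_le1 (theta ord0 i); rewrite -/(p i) /Y => p1 p0.
  by case: phi => /=; nra.
under eq_Rintegral => w _.
  rewrite (_ : (_ - _) * (_ - _) = Y i w * Y j w - p i * Y j w - p j * Y i w + p i * p j);
    last by ring.
  over.
have bc a k : bounded_rv (fun w => a * Y k w).
  by apply: bounded_rvM => //; exact: bounded_rv_cst.
have bYY : bounded_rv (fun w => Y i w * Y j w) by exact: bounded_rvM.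
rewrite RintegralD//; first last.
- by apply: bounded_rv_integrable; exact: bounded_rv_cst.
- by apply: bounded_rv_integrable; do 2 apply: bounded_rvB => //.
rewrite RintegralB//; first last.
- exact: bounded_rv_integrable.
- by apply: bounded_rv_integrable; apply: bounded_rvB.
rewrite RintegralB//; [|exact: bounded_rv_integrable..].
have EZ a k : \int[P]_w (a * Y k w) = a * p k.
  by rewrite RintegralZl// ?EY//; exact: bounded_rv_integrable.
rewrite EYY// !EZ Rintegral_prob_cst (mulrC (p j)) subrr sub0r addNr.
exact: ler0n.
Qed.

(** After expansion of the square into a double sum, the covariance bound leaves one unit per
    diagonal term. *)
Lemma true_positives_variance (S : {set 'I_n}) :
  \int[P]_w ((\sum_(i in S) (phi (theta ord0 i + eps i w))%:R -
     \sum_(i in S) shifted_power (theta ord0 i)) ^+ 2) <= #|S|%:R.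
Proof.
under eq_Rintegral => w _.
  rewrite -/(Y _ w) -sumrB expr2 big_distrlr/=.
  over.
rewrite Rintegral_sum; last first.
  by move=> i; apply: bounded_rv_sum => j; exact: (bounded_rvM _ _ (bYp i) (bYp j)).
rewrite -sum1_card natr_sum; apply: ler_sum => i iS.
rewrite Rintegral_sum; last by move=> j; exact: (bounded_rvM _ _ (bYp i) (bYp j)).
apply: (@le_trans _ _ (\sum_(j in S) (i == j)%:R)).
  by apply: ler_sum => j _; exact: cov.
rewrite (bigD1 i)//= eqxx big1 ?addr0// => j /andP[_].
by rewrite eq_sym => /negbTE ->.
Qed.

Let psi (x : 'rV[R]_n) (i : 'I_n) : bool := phi (x ord0 i).

Let psiE w i : psi (observation eps theta w) i = phi (theta ord0 i + eps i w).
Proof. by rewrite /psi /observation mxE. Qed.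

Lemma FNR_eq (q : nat) : (0 < q)%N -> #|support_set theta| = q ->
  FNR P eps theta psi =
    ((\sum_(i in support_set theta) (1 - shifted_power (theta ord0 i))) / q%:R)%:E.
Proof.
move=> q0 Sq; rewrite /FNR unlock.
under eq_integral => w _.
  rewrite /fnp Sq (maxn_idPl q0) natr_sum.
  rewrite (eq_bigr (fun i => 1 - Y i w)); last first.
    by move=> i _; rewrite psiE /Y; case: phi; rewrite ?subrr ?subr0.
  over.
have b1 i : bounded_rv (fun w => 1 - Y i w).
  by apply: bounded_rvB => //; exact: bounded_rv_cst.
have bs : bounded_rv (fun w => \sum_(i | theta ord0 i != 0) (1 - Y i w)).
  exact: bounded_rv_sum.
rewrite -[LHS]fineK; last first.
  apply: integrable_fin_num => //; apply: bounded_rv_integrable.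
  by apply: bounded_rvM => //; exact: bounded_rv_cst.
rewrite -/(Rintegral _ _ _); congr EFin; rewrite RintegralZr//; last first.
  exact: bounded_rv_integrable.
rewrite Rintegral_sum//; congr (_ / _).
apply: eq_big => [i|i _]; first by rewrite inE.
rewrite RintegralB//; last exact: bounded_rv_integrable.
  by rewrite Rintegral_prob_cst EY.
by apply: bounded_rv_integrable; exact: bounded_rv_cst.
Qed.

(** The false discovery proportion is dominated pointwise by a sum of two terms, so only the mean
    number of false positives and the variance of the number of true positives remain. The factor 2
    in the power hypothesis leaves a deviation of [delta * q] for Chebyshev's inequality. *)
Lemma FDR_le (q : nat) (delta : R) : (0 < q)%N -> #|support_set theta| = q ->
  0 < delta ->
  (forall i, i \in support_set theta -> 2 * delta <= shifted_power (theta ord0 i)) ->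
  (FDR P eps theta psi <=
    (n%:R * shifted_power 0 / (delta * q%:R) + (delta ^+ 2 * q%:R)^-1)%:E)%E.
Proof.
move=> q0 Sq d0 hp; rewrite /FDR unlock.
set S := support_set theta in Sq hp.
pose V w := \sum_(i | theta ord0 i == 0) Y i w.
pose TP w := \sum_(i in S) Y i w.
pose m := \sum_(i in S) p i.
have bV : bounded_rv V by exact: bounded_rv_sum.
have bTP : bounded_rv TP by exact: bounded_rv_sum.
have V0 w : 0 <= V w by rewrite sumr_ge0.
have TP0 w : 0 <= TP w by rewrite sumr_ge0.
have qR : 0 < q%:R :> R by rewrite ltr0n.
have fdpE w : fdp theta (psi (observation eps theta w)) =
    V w / Num.max (V w + TP w) 1.
  have numE : (\sum_(i | theta ord0 i == 0%R) psi (observation eps theta w) i)%N%:R = V w.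
    by rewrite natr_sum; apply: eq_bigr => i _; rewrite psiE.
  have denE : (\sum_i psi (observation eps theta w) i)%N%:R = V w + TP w.
    rewrite natr_sum (bigID (fun i => theta ord0 i == 0%R))/=.
    congr (_ + _); first by apply: eq_bigr => i _; rewrite psiE.
    by apply: eq_big => [i|i _]; rewrite ?inE// psiE.
  rewrite /fdp numE -denE; congr (_ / _).
  have [h|h] := leqP (\sum_i psi (observation eps theta w) i)%N 1.
    by rewrite max_r// -[leRHS]/(1%:R) ler_nat.
  by rewrite max_l// -[leLHS]/(1%:R) ler_nat ltnW.
have max_ge1 w : 1 <= Num.max (V w + TP w) 1 by rewrite le_max lexx orbT.
have max_gt0 w : 0 < Num.max (V w + TP w) 1 by exact: lt_le_trans (max_ge1 w).
have bfdp : bounded_rv (fun w => V w / Num.max (V w + TP w) 1).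
  split; last first.
    exists 1 => w; rewrite ger0_norm ?divr_ge0 ?(ltW (max_gt0 _))//.
    rewrite ler_pdivrMr// mul1r le_max.
    by rewrite lerDl TP0.
  apply: (eq_measurable_fun (fun w => V w * (Num.max (V w + TP w) 1) `^ (- 1))).
    by move=> w _; rewrite powR_inv1// ltW.
  apply: measurable_funM; first by case: bV.
  apply: (measurableT_comp (measurable_powR _)).
  apply: measurable_maxr => //.
  by apply: measurable_funD; [case: bV|case: bTP].
have bW : bounded_rv (fun w => V w * (delta * q%:R)^-1 +
    (TP w - m) ^+ 2 * (delta * q%:R)^-2).
  apply: bounded_rvD; apply: bounded_rvM => //; try exact: bounded_rv_cst.
  have bTPm : bounded_rv (fun w => TP w - m).
    by apply: bounded_rvB => //; exact: bounded_rv_cst.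
  by under eq_fun do rewrite expr2; exact: (bounded_rvM _ _ bTPm bTPm).
have dq0 : 0 < delta * q%:R by rewrite mulr_gt0.
have m_ge : 2 * (delta * q%:R) <= m.
  rewrite -Sq mulrA -sum1_card natr_sum mulr_sumr; apply: ler_sum => i iS.
  by rewrite mulr1 hp.
(* If TP < delta q then TP deviates by at least delta q from its mean m >= 2 delta q. *)
have fdp_le w : V w / Num.max (V w + TP w) 1 <=
    V w * (delta * q%:R)^-1 + (TP w - m) ^+ 2 * (delta * q%:R) ^- 2.
  have [h|h] := leP (delta * q%:R) (TP w).
    rewrite -[leLHS]addr0 lerD//.
      rewrite ler_wpM2l// lef_pV2 ?posrE//.
      by rewrite le_max (le_trans h)// lerDr.
    by rewrite mulr_ge0 ?sqr_ge0// invr_ge0 sqr_ge0.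
  rewrite -[leLHS]add0r; apply: lerD; first by rewrite divr_ge0 ?(ltW dq0).
  apply: (@le_trans _ _ 1).
    rewrite ler_pdivrMr// mul1r le_max.
    by rewrite lerDl TP0.
  rewrite ler_pdivlMr ?exprn_gt0// mul1r -(sqrrN (_ - _)) lerXn2r ?nnegrE ?(ltW dq0)//.
    by rewrite opprB subr_ge0 (le_trans (ltW h))// (le_trans _ m_ge)// ler_peMl ?(ltW dq0)// ler1n.
  by rewrite opprB lerBrDr; move: h m_ge; lra.
under eq_integral => w _ do rewrite fdpE.
rewrite -[leLHS]fineK; last exact/integrable_fin_num/bounded_rv_integrable.
rewrite lee_fin -/(Rintegral _ _ _).
apply: (@le_trans _ _ (\int[P]_w (V w * (delta * q%:R)^-1 +
    (TP w - m) ^+ 2 * (delta * q%:R) ^- 2))).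
  by apply: le_Rintegral => //; exact: bounded_rv_integrable.
have bT2 : bounded_rv (fun w => (TP w - m) ^+ 2).
  have bTPm : bounded_rv (fun w => TP w - m).
    by apply: bounded_rvB => //; exact: bounded_rv_cst.
  by under eq_fun do rewrite expr2; exact: (bounded_rvM _ _ bTPm bTPm).
have bcM f c : bounded_rv f -> bounded_rv (fun w => f w * c).
  by move=> bf; apply: bounded_rvM => //; exact: bounded_rv_cst.
rewrite RintegralD//; [|exact/bounded_rv_integrable/bcM..].
rewrite !RintegralZr//; [|exact: bounded_rv_integrable..].
apply: lerD.
  rewrite ler_wpM2r ?invr_ge0 ?(ltW dq0)// Rintegral_sum//.
  under eq_bigr => i _ do rewrite EY.
  rewrite (eq_bigr (fun=> shifted_power 0)); last by move=> i /eqP i0; rewrite /p i0.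
  rewrite sumr_const -[leLHS]mulr_natl ler_wpM2r ?shifted_power_ge0// ler_nat.
  by rewrite (leq_trans (max_card _))// card_ord.
rewrite (_ : (delta ^+ 2 * q%:R)^-1 = q%:R * (delta * q%:R) ^- 2); last first.
  by field; rewrite !gt_eqF.
rewrite ler_wpM2r ?invr_ge0 ?sqr_ge0// -Sq.
exact: true_positives_variance.
Qed.

End FixedMeans.

(** * Risk of a test squeezed between two-sided tests *)

Section TestAtFixedMeans.
Context {R : realType}.
Notation Phi := (@std_normal_cdf R).
Notation gauss := (@normal_prob R 0 1).
Variable phi : R -> bool.
Hypothesis mphi : measurable [set x | phi x].

(** Only the tail on the side of the sign of [t] is kept. *)
Lemma shifted_power_ge (h t : R) : (forall x, h <= `|x| -> phi x) ->
  Phi (`|t| - h) <= shifted_power phi t.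
Proof.
move=> hphi; have mt := measurable_shifted _ mphi t.
have [t0|t0] := leP 0 t.
  rewrite ger0_norm// -(opprB h) -[leLHS]/(fine (Phi (- (h - t)))%:E) -gauss_upper_tail.
  apply: fine_gauss_le => // z /=; rewrite in_itv/= andbT => hz; apply: hphi.
  by apply: le_trans (ler_norm _); lra.
rewrite ltr0_norm//; apply: fine_gauss_le => // z /=; rewrite in_itv/= => hz; apply: hphi.
rewrite -normrN; apply: le_trans (ler_norm _); lra.
Qed.

Lemma shifted_power_le (l t : R) : (forall x, phi x -> l <= `|x|) ->
  shifted_power phi t <= Phi (t - l) + Phi (- l - t).
Proof.
move=> lphi; have mt := measurable_shifted _ mphi t.
have mA : measurable (`]-oo, (- l - t)] : set R) by [].
have mB : measurable (`[(l - t), +oo[ : set R) by [].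
apply: (@le_trans _ _ (fine (gauss (`[(l - t), +oo[ `|` `]-oo, (- l - t)])))).
  apply: fine_gauss_le => //; first exact: measurableU.
  move=> z /= /lphi; rewrite ler_normr !in_itv/= andbT => /orP[]; [left|right]; lra.
have PhiE x : (Phi x)%:E = gauss `]-oo, x] by rewrite fineK// normal_prob_fin_num.
rewrite -lee_fin fineK; last by apply: normal_prob_fin_num; exact: measurableU.
by rewrite EFinD -(opprB l) -gauss_upper_tail PhiE; exact: measureU2.
Qed.

End TestAtFixedMeans.

Section RejectionSet.
Context {R : realType}.
Variables (L : R -> R) (K : R).
Hypothesis hprior : one_group_prior K 2^-1 L.

(** Stability under increasing |x| makes the trace of the region on each half-line an interval,
    hence Borel. *)
Lemma measurable_rejection (tau : R) :
  measurable [set x | 2^-1 < posterior_shrinkage 2^-1 L tau x].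
Proof.
set J := [set x | _].
have JE x : J x = (0 < contrast L tau x).
  by rewrite /J/= (posterior_shrinkage_gt_half _ _ hprior).
have Jmono x y : `|x| <= `|y| -> J x -> J y.
  rewrite !JE => xy x0; apply: lt_le_trans x0 _.
  exact: (contrast_homo _ _ hprior).
have -> : J = (J `&` `[0, +oo[) `|` (J `&` `]-oo, 0]).
  rewrite -setIUr; apply/seteqP; split => [x Jx|x []//]; split => //=.
  by rewrite !in_itv/= andbT; case: (leP 0 x) => [|/ltW]; [left|right].
apply: measurableU; apply: is_interval_measurable => x y /= [Jx].
  rewrite !in_itv/= !andbT => x0 [Jy y0] z /andP[xz zy]; split.
    by apply: Jmono Jx; rewrite !ger0_norm// (le_trans x0).
  by rewrite in_itv/= andbT (le_trans x0).
rewrite !in_itv/= => x0 [Jy y0] z /andP[xz zy]; split.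
  by apply: Jmono Jy; rewrite !ler0_norm ?lerN2// (le_trans zy).
by rewrite in_itv/= (le_trans zy).
Qed.

End RejectionSet.

Section RiskBounds.
Context {R : realType} {n : nat} {d : measure_display} {T : measurableType d}.
Variables (P : probability T R) (eps : 'I_n -> {RV P >-> R}).
Hypothesis heps : iid_std_normal eps.
Variable phi : R -> bool.
Hypothesis mphi : measurable [set x | phi x].
Notation Phi := (@std_normal_cdf R).
Let psi (x : 'rV[R]_n) (i : 'I_n) : bool := phi (x ord0 i).

Lemma FDR_ge0 theta : (0 <= FDR P eps theta psi)%E.
Proof. by apply: expectation_ge0 => w; rewrite divr_ge0. Qed.

Lemma FNR_ge0 theta : (0 <= FNR P eps theta psi)%E.
Proof. by apply: expectation_ge0 => w; rewrite divr_ge0. Qed.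

(** The upper threshold [h] and the beta-min condition bound every power below by [t]; the lower
    threshold [y] enters through the type I error alone. The factor 4 comes from [FDR_le] at
    [delta = t / 2] together with two Mills tails. *)
Lemma risk_le (q : nat) (b h y t : R) (theta : 'rV[R]_n) : (0 < q)%N -> 0 < y ->
  (forall x, h <= `|x| -> phi x) -> (forall x, phi x -> y <= `|x|) ->
  beta_min_class q b theta ->
  t = Phi (Num.sqrt (2 * ln (n%:R / q%:R)) + b - h) ->
  (risk P eps theta psi <=
    (4 / t * (n%:R / q%:R * (expR (- (y ^+ 2 / 2)) / y)) + (t ^+ 2 / 4 * q%:R)^-1
     + (1 - t))%:E)%E.
Proof.
move=> q0 y0 hphi lphi [Sq hmin] tE.
have t_gt0 : 0 < t by rewrite tE; exact: Phi_gt0.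
have qR : 0 < q%:R :> R by rewrite ltr0n.
have sp_ge i : i \in support_set theta -> t <= shifted_power phi (theta ord0 i).
  move=> iS; apply: le_trans (shifted_power_ge _ mphi _ _ hphi).
  by rewrite tE; apply: Phi_nondecreasing; rewrite lerD2r hmin.
have sp0 : shifted_power phi 0 <= 2 * (expR (- (y ^+ 2 / 2)) / y).
  apply: (le_trans (shifted_power_le _ mphi _ 0 lphi)).
  by rewrite sub0r subr0; have := Mills_upper y y0; lra.
rewrite /risk EFinD; apply: leeD.
  apply: (le_trans (FDR_le P eps heps phi mphi theta q (t / 2) q0 Sq _ _)).
  - by rewrite divr_gt0.
  - by move=> i iS; rewrite mulrCA divff ?mulr1// sp_ge.
  rewrite lee_fin expr_div_n -natrX lerD//.
  rewrite (_ : 4 / t * _ = n%:R * (2 * (expR (- (y ^+ 2 / 2)) / y)) / (t / 2 * q%:R)).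
    by rewrite ler_wpM2r ?invr_ge0 ?mulr_ge0 ?divr_ge0 ?(ltW t_gt0)// ler_wpM2l.
  by field; rewrite !gt_eqF.
rewrite (FNR_eq P eps heps phi mphi theta q q0 Sq) lee_fin.
rewrite ler_pdivrMr// -Sq -sum1_card natr_sum mulr_sumr; apply: ler_sum => i iS.
by rewrite mulr1 lerD2l lerN2 sp_ge.
Qed.

(** The first [q] coordinates carry the boundary value; its positivity makes them nonzero, so that
    the support has exactly [q] elements. *)
Lemma exists_boundary_mean (q : nat) (b : R) : (0 < q)%N -> (q <= n)%N ->
  0 < Num.sqrt (2 * ln (n%:R / q%:R)) + b ->
  exists2 theta : 'rV[R]_n, beta_min_class q b theta &
    forall i, i \in support_set theta ->
      theta ord0 i = Num.sqrt (2 * ln (n%:R / q%:R)) + b.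
Proof.
move=> q0 qn; set m := _ + b => m0.
pose theta : 'rV[R]_n := \row_i (if (i < q)%N then m else 0).
have SE i : (i \in support_set theta) = (i < q)%N.
  by rewrite inE mxE; case: ifP; rewrite ?eqxx// gt_eqF.
exists theta; last by move=> i; rewrite SE mxE => ->.
split; last by move=> i; rewrite SE mxE => ->; exact: ler_norm.
rewrite (eq_card (B := [set widen_ord qn j | j : 'I_q]%SET)).
  by rewrite card_imset ?card_ord// => i j /(congr1 val)/= /val_inj.
move=> i; rewrite SE; apply/idP/imsetP => [iq|[j _ ->]]; last exact: (ltn_ord j).
by exists (Ordinal iq) => //; exact: val_inj.
Qed.

(** The FDR is dropped: at the boundary mean the FNR alone reaches the limit. The term
    [Phi (- y - m)] accounts for rejections on the side opposite to the mean. *)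
Lemma risk_ge (q : nat) (b y m : R) : (0 < q)%N -> (q <= n)%N ->
  (forall x, phi x -> y <= `|x|) ->
  m = Num.sqrt (2 * ln (n%:R / q%:R)) + b -> 0 < m ->
  exists2 theta, beta_min_class q b theta &
    ((1 - (Phi (m - y) + Phi (- y - m)))%:E <= risk P eps theta psi)%E.
Proof.
move=> q0 qn lphi mE m0.
have [theta hth thetaE] : exists2 theta : 'rV[R]_n, beta_min_class q b theta &
    forall i, i \in support_set theta -> theta ord0 i = m.
  by rewrite mE; apply: exists_boundary_mean => //; rewrite -mE.
exists theta => //; have [Sq _] := hth.
have qR : 0 < q%:R :> R by rewrite ltr0n.
rewrite /risk (FNR_eq P eps heps phi mphi theta q q0 Sq).
rewrite -[leLHS]add0e leeD ?FDR_ge0// lee_fin.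
rewrite ler_pdivlMr// -[in leLHS]Sq -sum1_card natr_sum mulr_sumr; apply: ler_sum => i iS.
by rewrite mulr1 lerD2l lerN2 thetaE//; exact: shifted_power_le.
Qed.

End RiskBounds.

(** * Sparse asymptotics *)

Section SparseAsymptotics.
Context {R : realType}.
Notation Phi := (@std_normal_cdf R).
Variable q : nat -> nat.
Hypothesis hq_pos : forall n, (0 < q n)%N.
Hypothesis hq_sparse : (q n)%:R / n%:R @[n --> \oo] --> (0 : R).

Definition detection_level (n : nat) : R := Num.sqrt (2 * ln (n%:R / (q n)%:R)).

Let s := detection_level.

Lemma near_ratio_ge (c : R) : 0 < c -> \forall n \near \oo, c <= n%:R / (q n)%:R.
Proof.
move=> c0; have ci : 0 < c^-1 by rewrite invr_gt0.
have := cvgr0_norm_le _ hq_sparse _ ci => near_le.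
near=> n.
have n0 : 0 < n%:R :> R by rewrite ltr0n; near: n; exact: nbhs_infty_gt.
have qn0 : 0 < (q n)%:R :> R by rewrite ltr0n.
have : `|(q n)%:R / n%:R| <= c^-1 by near: n; exact: near_le.
rewrite ger0_norm ?divr_ge0// -[X in X <= _]invrK lef_pV2 ?posrE ?invr_gt0 ?divr_gt0//.
by rewrite invf_div.
Unshelve. all: by end_near. Qed.

Lemma near_q_le : \forall n \near \oo, (q n <= n)%N.
Proof.
have h1 := near_ratio_ge 1 ltr01; near=> n.
have : 1 <= n%:R / (q n)%:R :> R by near: n.
by rewrite ler_pdivlMr ?ltr0n// mul1r ler_nat.
Unshelve. all: by end_near. Qed.

Lemma near_level_ge (M : R) : \forall n \near \oo, M <= s n.
Proof.
have h1 := near_ratio_ge _ (expR_gt0 (M ^+ 2 / 2)); near=> n.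
have : expR (M ^+ 2 / 2) <= n%:R / (q n)%:R by near: n.
move=> h; rewrite (le_trans (ler_norm M))// -sqrtr_sqr /s /detection_level ler_wsqrtr//.
have r0 : 0 < n%:R / (q n)%:R :> R by rewrite (lt_le_trans _ h)// expR_gt0.
move: h; rewrite -{1}(lnK r0) ler_expR; lra.
Unshelve. all: by end_near. Qed.

(** The identity is only eventual: for [q n > n] the logarithm is negative and the square root is
    0. *)
Lemma near_expR_level : \forall n \near \oo, expR (s n ^+ 2 / 2) = n%:R / (q n)%:R.
Proof.
have h1 := near_ratio_ge 1 ltr01; near=> n.
have r1 : 1 <= n%:R / (q n)%:R :> R by near: n.
rewrite /s /detection_level sqr_sqrtr; last by rewrite mulr_ge0// ln_ge0.
rewrite mulrAC divff// mul1r lnK// posrE; exact: lt_le_trans r1.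
Unshelve. all: by end_near. Qed.

(** * Location of the critical value *)

Section Rejection.
Variables (L : R -> R) (K : R).
Hypothesis hprior : one_group_prior K 2^-1 L.
Hypothesis hA1 : assumption_A1 L.
Hypothesis hA2 : assumption_A2 L.
Variable tau : nat -> R.
Hypothesis htau_pos : forall n, 0 < tau n.
Hypothesis htau_0 : tau n @[n --> \oo] --> (0 : R).
Variable C : R.
Hypothesis hC : 0 < C.
Hypothesis htau_C : n%:R * tau n / (q n)%:R @[n --> \oo] --> C.

Let rejects n (x : R) := 2^-1 < posterior_shrinkage 2^-1 L (tau n) x.

Lemma near_tau_level : \forall n \near \oo,
  C / 2 <= tau n * expR (s n ^+ 2 / 2) <= 2 * C.
Proof.
have C0 := hC.
have hl := cvgr_ge _ htau_C (C / 2); have hu := cvgr_le _ htau_C (2 * C).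
have hE := near_expR_level.
near=> n.
have -> : expR (s n ^+ 2 / 2) = n%:R / (q n)%:R by near: n.
rewrite mulrCA mulrA; apply/andP; split; near: n; [apply: hl|apply: hu]; lra.
Unshelve. all: by end_near. Qed.

Lemma near_tau_le (t : R) : 0 < t -> \forall n \near \oo, tau n <= t.
Proof. by move=> t0; exact: cvgr_le _ htau_0 _ t0. Qed.

(** Combining exp(-x^2/2) <= A tau with tau <= 2 C exp(-s^2/2) gives s^2 - x^2 <= 2 ln D for D = 2 A
    C, a threshold within O(1/s) of s. *)
Lemma near_rejects_imp_large : exists2 D : R, 0 < D & \forall n \near \oo,
  forall x, rejects n x -> Num.sqrt (s n ^+ 2 - 2 * ln D) <= `|x|.
Proof.
have [c0 [t0 [c0_gt0 t0_gt0 L_ge]]] := hA1; have [M M_gt0 L_le] := hA2.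
have [A [tau0 [A0 tau0_gt0 hA]]] :=
  contrast_gt0_tail_bound _ _ hprior _ _ _ c0_gt0 t0_gt0 M_gt0 L_ge L_le.
have D0 : 0 < A * (2 * C) by rewrite !mulr_gt0.
exists (A * (2 * C)) => //.
have h1 := near_tau_le _ tau0_gt0; have h2 := near_tau_level.
near=> n => x; rewrite /rejects (posterior_shrinkage_gt_half _ _ hprior).
have tl : tau n <= tau0 by near: n.
move=> /(hA _ _ (htau_pos n) tl) hx.
have /andP[_ tu] : C / 2 <= tau n * expR (s n ^+ 2 / 2) <= 2 * C by near: n.
rewrite -sqrtr_sqr ler_wsqrtr//.
have : expR (s n ^+ 2 / 2 - x ^+ 2 / 2) <= expR (ln (A * (2 * C))).
  rewrite expRD lnK ?posrE//.
  apply: (@le_trans _ _ (expR (s n ^+ 2 / 2) * (A * tau n))).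
    by rewrite ler_pM2l ?expR_gt0.
  by rewrite mulrCA ler_pM2l// mulrC.
by rewrite ler_expR; lra.
Unshelve. all: by end_near. Qed.

(** Monotonicity in |x| reduces to x = s + e. The gain exp(s e) is at least (s e / 3)^3, whose cubic
    growth beats the required B x^2 <= 4 B s^2. *)
Lemma near_rejects_large (e : R) : 0 < e -> \forall n \near \oo,
  forall x, s n + e <= `|x| -> rejects n x.
Proof.
move=> e0; have C0 := hC.
have [c0 [t0 [c0_gt0 t0_gt0 L_ge]]] := hA1; have [M M_gt0 L_le] := hA2.
have [B [x0 [tau1 [B0 x0_gt0 tau1_gt0 hB]]]] :=
  contrast_gt0_of_large _ _ hprior _ _ _ c0_gt0 t0_gt0 M_gt0 L_ge L_le.
have h1 := near_tau_le _ tau1_gt0; have h2 := near_tau_level.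
have h3 := near_level_ge x0; have h4 := near_level_ge e.
(* The comparison of 4 B s^2 with (C / 2) (s e / 3)^3 = C e^3 s^3 / 54 asks for s > 216 B / (C e^3);
   217 makes it strict. *)
have h5 := near_level_ge (217 * B / (C * e ^+ 3)).
near=> n => x sx; rewrite /rejects (posterior_shrinkage_gt_half _ _ hprior).
have tl : tau n <= tau1 by near: n.
have sx0 : x0 <= s n by near: n.
have se : e <= s n by near: n.
have sB : 217 * B / (C * e ^+ 3) <= s n by near: n.
have /andP[tlo _] : C / 2 <= tau n * expR (s n ^+ 2 / 2) <= 2 * C by near: n.
have s0 : 0 < s n by exact: lt_le_trans se.
apply: (@lt_le_trans _ _ (contrast L (tau n) (s n + e))); last first.
  by apply: (contrast_homo _ _ hprior); rewrite ger0_norm// addr_ge0 ?ltW.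
apply: hB => //; first by rewrite (le_trans sx0)// lerDl ltW.
have ex : expR (s n ^+ 2 / 2) * (s n * e / 3) ^+ 3 <= expR ((s n + e) ^+ 2 / 2).
  apply: (@le_trans _ _ (expR (s n ^+ 2 / 2) * expR (s n * e))).
    rewrite ler_pM2l ?expR_gt0// -[s n * e in leRHS](divfK (_ : 3 != 0 :> R))//.
    rewrite expRM_natr lerXn2r ?nnegrE ?expR_ge0 ?divr_ge0 ?mulr_ge0 ?(ltW s0) ?(ltW e0)//.
    by rewrite (le_trans _ (expR_ge1Dx _))// lerDr.
  rewrite -expRD ler_expR sqrrD; have := sqr_ge0 e; lra.
apply: (@lt_le_trans _ _ (C / 2 * (s n * e / 3) ^+ 3)); last first.
  apply: le_trans (ler_wpM2l (ltW (htau_pos n)) ex).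
  by rewrite [leRHS]mulrA ler_wpM2r// exprn_ge0// divr_ge0// mulr_ge0 ?ltW.
apply: (@le_lt_trans _ _ (4 * B * s n ^+ 2)).
  rewrite (_ : 4 * B * s n ^+ 2 = B * (2 * s n) ^+ 2); last by ring.
  rewrite ler_pM2l// lerXn2r ?nnegrE ?addr_ge0 ?mulr_ge0 ?(ltW s0) ?(ltW e0)//.
  by move: se; lra.
move: sB; rewrite ler_pdivrMr ?mulr_gt0 ?exprn_gt0// => sB.
rewrite (_ : C / 2 * _ = s n * (C * e ^+ 3) * (s n ^+ 2 / 54)); last by field.
apply: (@lt_le_trans _ _ (217 * B * (s n ^+ 2 / 54))); last first.
  by rewrite ler_wpM2r// divr_ge0 ?sqr_ge0.
have := mulr_gt0 B0 (exprn_gt0 2 s0); lra.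
Unshelve. all: by end_near. Qed.

(** * Worst-case risk over the beta-min class *)

Variables (d : nat -> measure_display) (Omega : forall n, measurableType (d n)).
Variable P : forall n, probability (Omega n) R.
Variable eps : forall n, 'I_n -> {RV (P n) >-> R}.
Hypothesis heps : forall n, iid_std_normal (eps n).
Hypothesis hq_infty : (q n)%:R @[n --> \oo] --> (+oo : set_system R).

Let test_risk n theta := risk (P n) (eps n) theta (one_group_test 2^-1 L (tau n)).

Lemma near_risk_le (b e : R) : 0 < e -> \forall n \near \oo,
  forall theta, beta_min_class (q n) b theta -> (test_risk n theta <= (1 - Phi b + e)%:E)%E.
Proof.
move=> e0; set e3 := e / 3.
have e3_gt0 : 0 < e3 by rewrite divr_gt0.
have [D D0 hD] := near_rejects_imp_large.
have [t tE] : exists t, t = Phi (b - e3) by eexists.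
have t0 : 0 < t by rewrite tE Phi_gt0.
(* Chosen so that the type I term 4 D / (t y) is at most e / 3 once y >= Y. *)
have [Y YE] : exists Y, Y = 4 * D / (t * e3) by eexists.
have Y0 : 0 < Y by rewrite YE divr_gt0 ?mulr_gt0.
have hup := near_rejects_large _ e3_gt0.
(* As s <= s^2 for s >= 1, this yields s^2 - 2 ln D >= Y^2. *)
have hs := near_level_ge (1 + Y ^+ 2 + 2 * `|ln D|).
have hexp := near_expR_level.
have hqe : \forall n \near \oo, (t ^+ 2 / 4 * e3)^-1 <= (q n)%:R :> R.
  by move/cvgryPge : hq_infty; exact.
near=> n => theta hth.
have up x : s n + e3 <= `|x| -> rejects n x by move: x; near: n.
have low x : rejects n x -> Num.sqrt (s n ^+ 2 - 2 * ln D) <= `|x| by move: x; near: n.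
have sM : 1 + Y ^+ 2 + 2 * `|ln D| <= s n by near: n.
have sE : expR (s n ^+ 2 / 2) = n%:R / (q n)%:R by near: n.
have qe : (t ^+ 2 / 4 * e3)^-1 <= (q n)%:R by near: n.
have sY : Y ^+ 2 <= s n ^+ 2 - 2 * ln D.
  have s1 : 1 <= s n by have := sqr_ge0 Y; have := normr_ge0 (ln D); lra.
  have s2 : s n <= s n ^+ 2 by rewrite expr2 ler_peMr// (le_trans ler01).
  by have := ler_norm (ln D); lra.
have [y yE] : exists y, y = Num.sqrt (s n ^+ 2 - 2 * ln D) by eexists.
have yY : Y <= y by rewrite yE -[leLHS]ger0_norm ?(ltW Y0)// -sqrtr_sqr ler_wsqrtr.
have y0 : 0 < y by exact: lt_le_trans yY.
have y2 : y ^+ 2 = s n ^+ 2 - 2 * ln D.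
  by rewrite yE sqr_sqrtr// (le_trans _ sY)// sqr_ge0.
(* The exponential exactly compensates n/q up to the constant [D]; all the decay is left to 1/y. *)
have expy : n%:R / (q n)%:R * expR (- (y ^+ 2 / 2)) = D.
  rewrite -sE -expRD y2 (_ : _ + _ = ln D); last by field.
  by rewrite lnK.
have tE' : t = Phi (Num.sqrt (2 * ln (n%:R / (q n)%:R)) + b - (s n + e3)).
  by rewrite tE; congr (Phi _); rewrite /s /detection_level; ring.
have low' x : rejects n x -> y <= `|x| by rewrite yE; exact: low.
apply: (le_trans (risk_le (P n) (eps n) (heps n) (rejects n)
  (measurable_rejection _ _ hprior (tau n)) (q n) b _ y t theta (hq_pos n) y0 up low' hth tE')).
rewrite lee_fin [X in 4 / t * X]mulrA expy.
have bound1 : 4 / t * (D / y) <= e3.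
  rewrite mulrA ler_pdivrMr//.
  apply: (@le_trans _ _ (e3 * Y)); last by rewrite ler_pM2l.
  by rewrite YE le_eqVlt; apply/orP; left; apply/eqP; field; rewrite !gt_eqF.
have bound2 : (t ^+ 2 / 4 * (q n)%:R)^-1 <= e3.
  have a0 : 0 < t ^+ 2 / 4 by rewrite divr_gt0// exprn_gt0.
  have qR : 0 < (q n)%:R :> R by rewrite ltr0n.
  rewrite -[leRHS]invrK lef_pV2 ?posrE ?invr_gt0 ?mulr_gt0//.
  by move: qe; rewrite invfM ler_pdivrMl.
have bound3 : 1 - t <= 1 - Phi b + e3.
  have := Phi_lipschitz (b - e3) b; rewrite -tE gerBl ltW// => /(_ isT); lra.
by move: bound1 bound2 bound3; rewrite /e3; lra.
Unshelve. all: by end_near. Qed.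

Lemma near_risk_ge (b e : R) : 0 < e -> \forall n \near \oo,
  exists2 theta, beta_min_class (q n) b theta & ((1 - Phi b - e)%:E <= test_risk n theta)%E.
Proof.
move=> e0; set e2 := e / 2.
have e2_gt0 : 0 < e2 by rewrite divr_gt0.
have [D D0 hD] := near_rejects_imp_large.
have hq := near_q_le.
have hs1 := near_level_ge (1 - b); have hs2 := near_level_ge e2.
(* Equivalent to (s - e2)^2 <= s^2 - 2 ln D, which puts y above s - e2. *)
have hs3 := near_level_ge ((e2 ^+ 2 + 2 * ln D) / (2 * e2)).
(* Makes y + s + b at least 1/e2, hence the tail opposite to the mean at most e2. *)
have hs4 := near_level_ge (e2^-1 - b + e2).
near=> n.
have qn : (q n <= n)%N by near: n.
have low x : rejects n x -> Num.sqrt (s n ^+ 2 - 2 * ln D) <= `|x| by move: x; near: n.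
have s1 : 1 - b <= s n by near: n.
have s2 : e2 <= s n by near: n.
have s3 : (e2 ^+ 2 + 2 * ln D) / (2 * e2) <= s n by near: n.
have s4 : e2^-1 - b + e2 <= s n by near: n.
have [y yE] : exists y, y = Num.sqrt (s n ^+ 2 - 2 * ln D) by eexists.
have ys : s n - e2 <= y.
  rewrite yE -[leLHS]ger0_norm ?subr_ge0// -sqrtr_sqr ler_wsqrtr//.
  by move: s3; rewrite ler_pdivrMr ?mulr_gt0// sqrrB; lra.
have m0 : 0 < s n + b by lra.
have low' x : rejects n x -> y <= `|x| by rewrite yE; exact: low.
have [theta hth hr] := risk_ge (P n) (eps n) (heps n) (rejects n)
  (measurable_rejection _ _ hprior (tau n)) (q n) b y (s n + b) (hq_pos n) qn low' erefl m0.
exists theta => //; apply: le_trans hr; rewrite lee_fin.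
have bound1 : Phi (s n + b - y) <= Phi b + e2.
  apply: (@le_trans _ _ (Phi (b + e2))); first by apply: Phi_nondecreasing; lra.
  by have := Phi_lipschitz b (b + e2); rewrite lerDl ltW// => /(_ isT); lra.
have bound2 : Phi (- y - (s n + b)) <= e2.
  have ei : 0 < e2^-1 by rewrite invr_gt0.
  rewrite -opprD; apply: (@le_trans _ _ (Phi (- e2^-1))).
    by apply: Phi_nondecreasing; lra.
  by rewrite (le_trans (Phi_tail _ ei))// invrK.
by move: bound1 bound2; rewrite /e2; lra.
Unshelve. all: by end_near. Qed.

Lemma near_sup_risk_bounds (b e : R) : 0 < e -> \forall n \near \oo,
  let r := ereal_sup [set test_risk n theta | theta in beta_min_class (q n) b] in
  ((1 - Phi b - e)%:E <= r)%E /\ (r <= (1 - Phi b + e)%:E)%E.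
Proof.
move=> e0; have hle := near_risk_le b e e0; have hge := near_risk_ge b e e0.
near=> n => /=; split.
  have [theta hth hr] : exists2 theta, beta_min_class (q n) b theta &
    ((1 - Phi b - e)%:E <= test_risk n theta)%E by near: n.
  by apply: (le_trans hr); apply: ereal_sup_ubound; exists theta.
apply: ge_ereal_sup => _ [theta hth <-]; move: theta hth; near: n; exact: hle.
Unshelve. all: by end_near. Qed.

(** The class shrinks as b grows, so the risk is bounded by that at the fixed level 1/e2, where 1 -
    Phi is already at most e2. The lower bound holds because 1 - Phi (b n) - e is eventually
    nonpositive. *)
Lemma near_sup_risk_bounds_infty (b : nat -> R) (e : R) : b n @[n --> \oo] --> +oo ->
  0 < e -> \forall n \near \oo,
  let r := ereal_sup [set test_risk n theta | theta in beta_min_class (q n) (b n)] in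
  ((1 - Phi (b n) - e)%:E <= r)%E /\ (r <= (1 - Phi (b n) + e)%:E)%E.
Proof.
move=> hb e0; set e2 := e / 2; have e2_gt0 : 0 < e2 by rewrite divr_gt0.
have ei : 0 < e2^-1 by rewrite invr_gt0.
have hle := near_risk_le e2^-1 e2 e2_gt0.
have hbn : \forall n \near \oo, e2^-1 <= b n by move/cvgryPge : hb; exact.
have hq := near_q_le; have hs := near_level_ge 0.
near=> n => /=.
have bn : e2^-1 <= b n by near: n.
have sn : 0 <= s n by near: n.
have qn : (q n <= n)%N by near: n.
have tail x : e2^-1 <= x -> 1 - Phi x <= e2.
  move=> ex; rewrite -Phi_opp; apply: (@le_trans _ _ (Phi (- e2^-1))).
    by apply: Phi_nondecreasing; rewrite lerN2.
  by rewrite (le_trans (Phi_tail _ ei))// invrK.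
split.
  have m0 : 0 < s n + b n by rewrite ltr_wpDl// (lt_le_trans ei).
  (* This witnesses nonemptiness of the class: the supremum of the empty set would be -oo. *)
  have [theta hth _] := exists_boundary_mean (q n) (b n) (hq_pos n) qn m0.
  apply: (@le_trans _ _ (test_risk n theta)); last first.
    by apply: ereal_sup_ubound; exists theta.
  apply: (@le_trans _ _ 0%E); last by apply: adde_ge0;
    [exact: (FDR_ge0 _ _ (rejects n))|exact: (FNR_ge0 _ _ (rejects n))].
  by rewrite lee_fin; have := tail _ bn; rewrite /e2; lra.
apply: ge_ereal_sup => _ [theta [Sq hth] <-].
apply: (@le_trans _ _ (1 - Phi e2^-1 + e2)%:E).
  have : beta_min_class (q n) e2^-1 theta.
    by split => // i /hth; apply: le_trans; rewrite lerD2l.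
  by move: theta {Sq hth}; near: n; exact: hle.
rewrite lee_fin; have := tail _ (lexx _); have := Phi_le1 (b n); rewrite /e2; lra.
Unshelve. all: by end_near. Qed.

End Rejection.
End SparseAsymptotics.

(** The bounds at e = 1 make [u n] eventually finite, after which the convergence is one of real
    numbers. *)
Lemma cvge0_of_bounds (R : realType) (u : nat -> \bar R) (l : nat -> R) :
  (forall e : R, 0 < e -> \forall n \near \oo,
     ((l n - e)%:E <= u n)%E /\ (u n <= (l n + e)%:E)%E) ->
  (u n - (l n)%:E)%E @[n --> \oo] --> 0%E.
Proof.
move=> h; apply/fine_cvgP; split.
  have h1 := h 1 ltr01; near=> n.
  have [lo hi] : ((l n - 1)%:E <= u n)%E /\ (u n <= (l n + 1)%:E)%E by near: n.
  by move: lo hi; case: (u n) => [r| |].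
apply/cvgrPdist_le => e e0; have he := h e e0; near=> n.
have [lo hi] : ((l n - e)%:E <= u n)%E /\ (u n <= (l n + e)%:E)%E by near: n.
move: lo hi => /=; case: (u n) => [r| |]//=; rewrite !lee_fin => lo hi.
by rewrite sub0r normrN ler_norml; apply/andP; split; lra.
Unshelve. all: by end_near. Qed.

Theorem theorem4 (R : realType)
  (K : R) (L : R -> R)
  (hprior : one_group_prior K (2^-1) L)
  (hA1 : assumption_A1 L) (hA2 : assumption_A2 L)
  (q : nat -> nat)
  (hq_pos : forall n, (0 < q n)%N)
  (hq_infty : (q n)%:R @[n --> \oo] --> (+oo : set_system R))
  (hq_sparse : (q n)%:R / n%:R @[n --> \oo] --> (0 : R))
  (tau : nat -> R)
  (htau_pos : forall n, 0 < tau n)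
  (htau_0 : tau n @[n --> \oo] --> (0 : R))
  (C : R) (hC : 0 < C)
  (htau_C : n%:R * tau n / (q n)%:R @[n --> \oo] --> C)
  (d : nat -> measure_display) (Omega : forall n, measurableType (d n))
  (P : forall n, probability (Omega n) R)
  (eps : forall n, 'I_n -> {RV (P n) >-> R})
  (heps : forall n, iid_std_normal (eps n)) :
  (forall b : R,
     (ereal_sup [set risk (P n) (eps n) theta (one_group_test 2^-1 L (tau n))
                | theta in beta_min_class (q n) b]
       - (1 - std_normal_cdf b)%:E)%E @[n --> \oo] --> 0%E) /\
  (forall b : nat -> R, b n @[n --> \oo] --> +oo ->
     (ereal_sup [set risk (P n) (eps n) theta (one_group_test 2^-1 L (tau n))
                | theta in beta_min_class (q n) (b n)]
       - (1 - std_normal_cdf (b n))%:E)%E @[n --> \oo] --> 0%E).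
Proof.
split=> b; [|move=> hb]; apply: cvge0_of_bounds => e e0.
  exact: (near_sup_risk_bounds q hq_pos hq_sparse L K hprior hA1 hA2 tau htau_pos
    htau_0 C hC htau_C d Omega P eps heps hq_infty b e e0).
exact: (near_sup_risk_bounds_infty q hq_pos hq_sparse L K hprior hA1 hA2 tau htau_pos
  htau_0 C hC htau_C d Omega P eps heps hq_infty b e hb e0).
Qed.
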